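(* Let $\alpha\in(-\infty,1)$, $p,q\in[1,\infty)$, $\gamma\in[q,\infty)$ with $\frac1\gamma=\frac1p+\frac1n$, and let $L:\mathbb{R}\to\mathbb{R}$ be a continuous mapping. Then (i) the left composition operator $\mathscr{C}_L$ is bounded on $JNQ^{\alpha}_{p,q}(\mathbb{R}^n)$ if and only if $L\in\mathrm{Lip}(\mathbb{R})$; (ii) $f\in JNQ^{\alpha}_{p,q}(\mathbb{R}^n)$ if and only if there exists a $g\in JNQ^{\alpha}_{p,q}(\mathbb{R}^n)$ such that $\frac1g\in JNQ^{\alpha}_{p,q}(\mathbb{R}^n)$ and $f=g-\frac1g$.
   Context: Here $n\in\mathbb{N}$, $n\ge1$, and functions are real-valued. A measurable function $f$ on $\mathbb{R}^n$ is a Lebesgue measurable function with $|f|<\infty$ almost everywhere. A cube has finite positive edge length and all its edges parallel to the coordinate axes, and need not be open or closed. For $\ell\in(0,\infty)$, $\Pi_\ell$ is the class of all collections $\{Q_j\}_j$ of cubes of $\mathbb{R}^n$ with pairwise disjoint interiors and equal edge length $\ell$. The space $JNQ^{\alpha}_{p,q}(\mathbb{R}^n)$ is the set of all measurable $f$ on $\mathbb{R}^n$ with $$\|f\|_{JNQ^\alpha_{p,q}(\mathbb{R}^n)}:=\sup_{\ell\in(0,\infty),\,\{Q_j\}_j\in\Pi_\ell}\Big\{\sum_j|Q_j|\Big[|Q_j|^{\frac{q\alpha}{n}-1}\int_{Q_j}\int_{Q_j}\frac{|f(x)-f(y)|^q}{|x-y|^{n+q\alpha}}\,dy\,dx\Big]^{p/q}\Big\}^{1/p}<\infty.$$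 The left composition operator is $\mathscr{C}_L(f)(x):=L(f(x))$; it is bounded on $JNQ^{\alpha}_{p,q}(\mathbb{R}^n)$ if there is a positive constant $C$ with $\|\mathscr{C}_L(f)\|_{JNQ^{\alpha}_{p,q}(\mathbb{R}^n)}\le C\|f\|_{JNQ^{\alpha}_{p,q}(\mathbb{R}^n)}$ for all $f\in JNQ^{\alpha}_{p,q}(\mathbb{R}^n)$. $\mathrm{Lip}(\mathbb{R})$ is the set of all measurable functions $h$ on $\mathbb{R}$ with $\sup\{|h(x)-h(y)|/|x-y|:\ x\ne y\}<\infty$. *)

(* Defs.v *)
From HB Require Import structures.
From mathcomp Require Import all_boot all_order all_algebra.
From mathcomp Require Import all_classical all_reals all_analysis.

Set Implicit Arguments.
Unset Strict Implicit.
Unset Printing Implicit Defensive.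

Import Order.TTheory GRing.Theory Num.Theory.
Import numFieldNormedType.Exports.

Local Open Scope classical_set_scope.
Local Open Scope ring_scope.

Section LebesgueOuter.
Context (R : realType) (n : nat).
Local Open Scope ereal_scope.

Definition box (c : 'rV[R]_n * 'rV[R]_n) : set 'rV[R]_n :=
  [set x | forall i, (c.1 ord0 i < x ord0 i < c.2 ord0 i)%R].

(* If some side is nonpositive then the open box is empty, and so the volume
   is cut off at 0. *)
Definition box_vol (c : 'rV[R]_n * 'rV[R]_n) : R :=
  (\prod_(i < n) Num.max 0 (c.2 ord0 i - c.1 ord0 i))%R.

Definition box_cover (A : set 'rV[R]_n) : set (set ('rV[R]_n * 'rV[R]_n)) :=
  [set D | countable D /\ A `<=` \bigcup_(c in D) box c].

Definition lebesgue_outer (A : set 'rV[R]_n) : \bar R :=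
  ereal_inf [set \esum_(c in D) (box_vol c)%:E | D in box_cover A].

Lemma box_vol_ge0 c : 0 <= (box_vol c)%:E.
Proof. by rewrite lee_fin; apply: prodr_ge0 => i _; rewrite le_max lexx. Qed.

Lemma lebesgue_outer_ge0 A : 0 <= lebesgue_outer A.
Proof.
apply: le_ereal_inf_tmp => _ [D _ <-].
by apply: esum_ge0 => c _; exact: box_vol_ge0.
Qed.

Lemma lebesgue_outer0 : lebesgue_outer set0 = 0.
Proof.
apply/eqP; rewrite eq_le lebesgue_outer_ge0 andbT.
apply: ereal_inf_lbound; exists set0; last by rewrite esum_set0.
by split=> //; exact: countable0.
Qed.

Lemma le_lebesgue_outer : {homo lebesgue_outer : A B / A `<=` B >-> A <= B}.
Proof.
move=> A B AB; apply/ereal_inf_le_tmp => _ [D [cD BD] <-].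
by exists D => //; split=> //; exact: subset_trans AB BD.
Qed.

Lemma lebesgue_outer_sigma_subadditive : sigma_subadditive lebesgue_outer.
Proof.
move=> A; have [[i ioo]|] := pselect (exists i, lebesgue_outer (A i) = +oo).
  rewrite (eseries_pinfty _ _ ioo) ?leey// => m _.
  by rewrite -ltNye (lt_le_trans _ (lebesgue_outer_ge0 _)).
rewrite -forallNE => Aoo.
apply/lee_addgt0Pr => e e0.
apply: (le_trans _ (epsilon_trick _ (fun m => lebesgue_outer_ge0 (A m))
  (ltW e0))).
pose P m D := box_cover (A m) D /\
  \esum_(c in D) (box_vol c)%:E <=
    lebesgue_outer (A m) + (e / (2 ^ m.+1)%:R)%:E.
have [D PD] : {D : nat -> set _ & forall m, P m (D m)}.
  apply: (@choice _ _ P) => m; rewrite /P.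
  have fA : lebesgue_outer (A m) \is a fin_num.
    by rewrite ge0_fin_numE ?lebesgue_outer_ge0// ltey; exact/eqP/Aoo.
  have em : (0 < e / (2 ^ m.+1)%:R)%R by rewrite divr_gt0// ltr0n expn_gt0.
  have [_ [D cD <-] lD] := lb_ereal_inf_adherent em fA.
  by exists D; split=> //; exact: ltW.
have esD m : 0 <= \esum_(c in D m) (box_vol c)%:E.
  by apply: esum_ge0 => c _; exact: box_vol_ge0.
apply: (@le_trans _ _ (\sum_(m <oo) \esum_(c in D m) (box_vol c)%:E)).
  apply: (@le_trans _ _ (\esum_(c in \bigcup_m D m) (box_vol c)%:E)).
    apply: ereal_inf_lbound; exists (\bigcup_m D m) => //; split.
      by apply: bigcup_countable => // m _; have [[]] := PD m.
    move=> x [m _ /(PD m).1.2[c Dc bc]].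
    by exists c => //; exists m.
  rewrite nneseries_esumT//.
  rewrite (@esum_esum _ _ _ setT D (fun _ c => (box_vol c)%:E)); last first.
    by move=> *; exact: box_vol_ge0.
  have [f fP] : {f : _ -> nat & forall c, (\bigcup_m D m) c -> D (f c) c}.
    apply: (@choice _ _ (fun c m => (\bigcup_m D m) c -> D m c)) => c.
    have [[m _ Dmc]|nD] := pselect ((\bigcup_m D m) c); first by exists m.
    by exists 0%N => /nD.
  pose g c := (f c, c).
  have -> : \esum_(c in \bigcup_m D m) (box_vol c)%:E =
            \esum_(k in g @` \bigcup_m D m) (box_vol k.2)%:E.
    by rewrite esum_image// => c d _ _ [].
  apply: ge_ereal_sup => _ [X [finX XD] <-]; apply: ereal_sup_ubound.
  by exists X => //; split=> // k /XD[c Dc <-]; split=> //=; exact: fP.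
apply: lee_nneseries => m _ //; exact: (PD m).2.
Qed.

HB.instance Definition _ := isOuterMeasure.Build R 'rV[R]_n lebesgue_outer
  lebesgue_outer0 lebesgue_outer_ge0 le_lebesgue_outer
  lebesgue_outer_sigma_subadditive.

End LebesgueOuter.

Arguments lebesgue_outer R n : clear implicits.

(* R^n with the sigma-algebra of Lebesgue measurable sets; it is convertible to
   'rV[R]_n. *)
Notation Rn R n := (caratheodory_type (lebesgue_outer R n)).

Definition lebesgue (R : realType) (n : nat) : set (Rn R n) -> \bar R :=
  lebesgue_outer R n.

HB.instance Definition _ (R : realType) (n : nat) :=
  isMeasure.Build _ _ _ (@lebesgue R n)
    (@caratheodory_measure0 _ _ (lebesgue_outer R n))
    (@caratheodory_measure_ge0 _ _ (lebesgue_outer R n))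
    (@caratheodory_measure_sigma_additive _ _ (lebesgue_outer R n)).

Arguments lebesgue R n : clear implicits.

Section JNQ.
Context (R : realType) (n : nat).

(* The library norm on 'rV[R]_n is the sup norm. *)
Definition enorm (x : 'rV[R]_n) : R :=
  Num.sqrt (\sum_(i < n) (x ord0 i) ^+ 2).

(* Each of the endpoints of each of the edges may or may not belong to the
   cube. *)
Definition is_cube (l : R) (Q : set 'rV[R]_n) : Prop :=
  exists (a : 'rV[R]_n) (b c : 'I_n -> bool),
    Q = [set x | forall i, x ord0 i \in
      Interval (BSide (b i) (a ord0 i)) (BSide (c i) (a ord0 i + l))].

Definition cube_collection (l : R) : set (set (set 'rV[R]_n)) :=
  [set P | (forall Q, P Q -> is_cube l Q) /\ trivIset P (fun Q => Q°)].

Definition lebesgue_measurable_fun (f : 'rV[R]_n -> R) : Prop :=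
  measurable_fun [set: Rn R n] (f : Rn R n -> R).

Definition oscillation (alpha q : R) (f : 'rV[R]_n -> R) (Q : set (Rn R n)) :
    \bar R :=
  (lebesgue R n Q `^ (q * alpha / n%:R - 1) *
   \int[lebesgue R n]_(x in Q) \int[lebesgue R n]_(y in Q)
     (`|f x - f y| `^ q / enorm (x - y) `^ (n%:R + q * alpha))%:E)%E.

Definition JNQ_norm (alpha p q : R) (f : 'rV[R]_n -> R) : \bar R :=
  ereal_sup [set z | exists (l : R) (P : set (set 'rV[R]_n)),
    [/\ 0 < l, cube_collection l P &
        z = ((\esum_(Q in P) (lebesgue R n Q * oscillation alpha q f Q `^ (p / q)))
              `^ p^-1)%E]].

(* A measurable function is finite almost everywhere; here functions are
   real-valued everywhere, and the identities between them that involve a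
   quotient are stated almost everywhere. *)
Definition JNQ (alpha p q : R) : set ('rV[R]_n -> R) :=
  [set f | lebesgue_measurable_fun f /\ (JNQ_norm alpha p q f < +oo)%E].

Definition left_composition (L : R -> R) (f : 'rV[R]_n -> R) :
  'rV[R]_n -> R := fun x => L (f x).

Definition bounded_on_JNQ (alpha p q : R)
    (T : ('rV[R]_n -> R) -> ('rV[R]_n -> R)) : Prop :=
  exists2 C : R, 0 < C & forall f, JNQ alpha p q f ->
    (JNQ_norm alpha p q (T f) <= C%:E * JNQ_norm alpha p q f)%E.

End JNQ.

(* The domain carries the Lebesgue, not the Borel, sigma-algebra of R. *)
Definition Lip (R : realType) : set (R -> R) :=
  [set h : R -> R |
    measurable_fun [set: caratheodory_type (@wlength R idfun)^*%mu]
      (h : caratheodory_type (@wlength R idfun)^*%mu -> R) /\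
    (ereal_sup [set z | exists x y : R,
       x != y /\ z = (`|h x - h y| / `|x - y|)%:E] < +oo)%E].
Arguments Lip R : clear implicits.

(* Main.v *)
Require Import Defs.
From HB Require Import structures.
From mathcomp Require Import all_boot all_order all_algebra.
From mathcomp Require Import all_classical all_reals all_analysis.
From mathcomp Require Import measurable_realfun lra ring.

Set Implicit Arguments.
Unset Strict Implicit.
Unset Printing Implicit Defensive.

Import Order.TTheory GRing.Theory Num.Theory.
Import numFieldNormedType.Exports.

Local Open Scope classical_set_scope.
Local Open Scope ring_scope.

(** Composition with a Lipschitz map multiplies every difference quotient by at
    most the q-th power of its Lipschitz constant, hence the JNQ norm by at most
    the constant itself ([JNQ_norm_lipschitz]).

    Conversely, boundedness of the composition operator is tested on the
    functions b + (a - b) phi, where phi is a Lipschitz bump equal to 1 on the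
    unit sup-norm ball and to 0 off the ball of radius 2.  Their norm is at most
    |a - b| times that of phi, whereas their composition with L takes the values
    L a and L b on two fixed boxes inside one cube, so that its norm is at least
    c |L a - L b| ([JNQ_norm_jump_ge]).  Comparing the two bounds makes L
    Lipschitz.

    All this needs phi to have finite norm ([JNQ_bump]), and there the relation
    between the exponents enters.  Put t = q (1 - alpha) > 0 and let Q be a cube
    of side l.  The difference quotient of phi is at most
    |x - y| ^ (q - n - q alpha), whose integral in one variable over Q is
    O(l ^ t) by summation over dyadic shells ([riesz_kernel_integral_le]), and
    it vanishes unless x or y lies in the support of phi.  If m is the measure
    of the part of that support in Q, then Q contributes at most a multiple of
    l ^ n (l ^ (q - n) m) ^ (p / q) to the sum that defines the norm.  One
    factor m is kept: over disjoint cubes these sum to the measure of the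
    support.  The other factor m ^ (p / q - 1) is at most l ^ (n (p / q - 1)),
    which leaves l ^ p, good for l <= 1; it is also bounded by a constant, which
    leaves l ^ (n + (q - n) p / q), good for l >= 1, since that exponent is
    n p (1/p + 1/n - 1/q) and q <= gamma says that this is nonpositive
    ([powR_scale_le]).

    For the second part, t = u - 1/u is solved by u = (t + sqrt (t ^ 2 + 4)) / 2,
    and both u and 1/u are 1-Lipschitz functions of t; so g = u o f and its
    inverse belong to the space as soon as f does.  The other implication is a
    quasi-triangle inequality ([JNQ_norm_sub]), for which Tonelli's theorem
    provides the measurability of the inner integrals.

    What is used of Lebesgue measure in dimension n is that coordinates are
    measurable and that a cube of side l has measure l ^ n; the lower bound is
    [box_cover_vol]. *)

(** * Lebesgue outer measure: hyperplanes and half-spaces *)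

Section OuterMeasure.
Context (R : realType).
Local Open Scope ereal_scope.

(** Lets a sum over a countable cover be treated as a series over nat, for which
    monotone convergence and sigma-subadditivity are stated.  The predicate P
    marks the indices that are really used, so that D may be finite or empty. *)
Lemma countable_esumE (T : pointedType) (D : set T) : countable D ->
  exists (g : nat -> T) (P : pred nat),
    (forall c, D c <-> exists2 k, P k & g k = c) /\
    forall F : T -> \bar R, (forall c, 0 <= F c) ->
      \esum_(c in D) F c = \sum_(k <oo) (P k)%:R%:E * F (g k).
Proof.
move=> /countable_injP[f injf].
pose g := 'pinv_(fun=> point) D f; exists g, (fun k => k \in f @` D).
have gf c : D c -> g (f c) = c by move=> Dc; rewrite /g pinvKV// inE.
split.
  move=> c; split=> [Dc|[k]].
    by exists (f c); rewrite ?gf// inE; exists c.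
  by rewrite inE => -[d Dd <-]; rewrite gf// => <-.
move=> F F0.
transitivity (\esum_(c in D) F (g (f c))).
  by apply: eq_esum => c Dc; rewrite gf.
rewrite -(@esum_image _ _ _ D f (fun k => F (g k))) ?set_injP//.
rewrite nneseries_esumT; last by move=> k; rewrite mule_ge0// lee_fin ler0n.
rewrite esum_mkcond; apply: eq_esum => k _.
by case: ifP => _; rewrite ?mul1e ?mul0e.
Qed.

Context (n : nat).
Local Notation mu := (lebesgue_outer R n).

Lemma lebesgue_outer_box (c : 'rV[R]_n * 'rV[R]_n) : mu (box c) <= (box_vol c)%:E.
Proof.
apply: ereal_inf_lbound; exists [set c]; last by rewrite esum_set1// box_vol_ge0.
by split; [exact: countable1|move=> x cx; exists c].
Qed.

Lemma lebesgue_outer_countable (T : pointedType) (D : set T) (F : T -> set 'rV[R]_n) :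
  countable D -> mu (\bigcup_(c in D) F c) <= \esum_(c in D) mu (F c).
Proof.
move=> /countable_esumE[g [P [gP ->]]]; last by move=> c; exact: lebesgue_outer_ge0.
have -> : \bigcup_(c in D) F c = \bigcup_k (if P k then F (g k) else set0).
  apply/seteqP; split=> x [].
    by move=> c /gP[k Pk <-] Fx; exists k; rewrite // Pk.
  move=> k _; case: ifPn => // Pk Fx; exists (g k) => //.
  by apply/gP; exists k.
apply: le_trans (@outer_measure_sigma_subadditive _ _ mu _) _.
apply: lee_nneseries => [k _ _|k _] /=; first exact: lebesgue_outer_ge0.
by case: (P k); rewrite ?mul1e// mul0e lebesgue_outer0.
Qed.

Lemma lebesgue_outer_subadditive (A B : set 'rV[R]_n) :
  mu (A `|` B) <= mu A + mu B.
Proof. exact: (@outer_measureU2 _ _ mu). Qed.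

Definition hyperplane (i : 'I_n) (t : R) : set 'rV[R]_n := [set x | x ord0 i = t].

(** The part of a hyperplane in a bounded box is covered by one slab whose
    thickness is as small as desired, and countably many such parts exhaust the
    hyperplane. *)
Lemma lebesgue_outer_hyperplane i t : mu (hyperplane i t) = 0.
Proof.
have sub : hyperplane i t `<=` \bigcup_(k in [set: nat])
    (hyperplane i t `&` box (const_mx (- k%:R), const_mx k%:R)%R).
  move=> x xt; pose M := (\sum_(j < n) `|x ord0 j|)%R.
  exists (Num.bound M) => //; split=> // j /=.
  rewrite !mxE -ltr_norml.
  apply: le_lt_trans (archi_boundP _); last by apply: sumr_ge0.
  by rewrite /M (bigD1 j)//= lerDl; apply: sumr_ge0.
apply/eqP; rewrite eq_le lebesgue_outer_ge0 andbT.
apply: le_trans (le_lebesgue_outer sub) _.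
apply: le_trans (lebesgue_outer_countable _ _) _; first exact: countableP.
rewrite esum1// => k _; apply/eqP; rewrite eq_le lebesgue_outer_ge0 andbT.
apply/lee_addgt0Pr => e e0; rewrite add0e.
pose M := (\prod_(j < n | j != i) Num.max 0 (k%:R - - k%:R) : R)%R.
have M0 : (0 <= M)%R by apply: prodr_ge0 => j _; rewrite le_max lexx.
(* The slab of half-width d has volume 2 * d * M, and M + 1 avoids a division
   by zero. *)
pose d := (e / (2 * (M + 1)))%R.
have d0 : (0 < d)%R by rewrite divr_gt0// mulr_gt0// ltr_wpDl.
pose a : 'rV[R]_n := (\row_j if j == i then t - d else - k%:R)%R.
pose b : 'rV[R]_n := (\row_j if j == i then t + d else k%:R)%R.
apply: (@le_trans _ _ (mu (box (a, b)))).
  apply: le_lebesgue_outer => x [xt xk] j; rewrite /= !mxE.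
  case: eqP => [->|_]; last by have := xk j; rewrite /= !mxE.
  by rewrite xt ltrBlDr ltrDl d0.
apply: le_trans (lebesgue_outer_box _) _; rewrite lee_fin /box_vol (bigD1 i)//=.
rewrite !mxE eqxx.
under eq_bigr => j /negbTE ji do rewrite !mxE ji.
rewrite -/M (_ : t + d - (t - d) = 2 * d)%R; last by ring.
rewrite max_r; last by rewrite mulr_ge0// ltW.
have -> : (2 * d * M = e * (M / (M + 1)))%R.
  by rewrite /d; field; rewrite gt_eqF// ltr_wpDl.
by rewrite ler_piMr ?(ltW e0)// ler_pdivrMr ?mul1r ?lerDl// ltr_wpDl.
Qed.

(** Each box of a cover is cut in two by the bounding hyperplane, which keeps
    its total volume; the open pieces miss only points of the hyperplane, a null
    set. *)
Lemma measurable_halfspace i t :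
  mu.-caratheodory [set x : 'rV[R]_n | (x ord0 i < t)%R].
Proof.
set A := [set x | _].
apply: le_caratheodory_measurable => X.
apply: le_ereal_inf_tmp => _ [D [cD XD] <-].
pose cl (c : 'rV[R]_n * 'rV[R]_n) :=
  (c.1, (\row_j if j == i then Num.min t (c.2 ord0 j) else c.2 ord0 j) : 'rV[R]_n)%R.
pose cr (c : 'rV[R]_n * 'rV[R]_n) :=
  ((\row_j if j == i then Num.max t (c.1 ord0 j) else c.1 ord0 j) : 'rV[R]_n, c.2)%R.
have Xl : mu (X `&` A) <= \esum_(c in D) (box_vol (cl c))%:E.
  apply: (@le_trans _ _ (\esum_(c in D) mu (box (cl c)))); last first.
    by apply: le_esum => c _; exact: lebesgue_outer_box.
  apply: le_trans (lebesgue_outer_countable _ cD).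
  apply: le_lebesgue_outer => x [/XD[c Dc xc] xA]; exists c => // j /=.
  rewrite mxE; have /andP[-> /=] := xc j.
  by case: eqP => // ->; rewrite lt_min => ->; rewrite andbT.
have Xr : mu (X `&` ~` A) <= \esum_(c in D) (box_vol (cr c))%:E.
  apply: (@le_trans _ _ (\esum_(c in D) mu (box (cr c)))); last first.
    by apply: le_esum => c _; exact: lebesgue_outer_box.
  apply: le_trans (lebesgue_outer_countable _ cD).
  rewrite -[leRHS]adde0 -(lebesgue_outer_hyperplane i t).
  apply: le_trans (lebesgue_outer_subadditive _ _).
  apply: le_lebesgue_outer => x [/XD[c Dc xc] /negP].
  rewrite -leNgt le_eqVlt => /orP[/eqP xt|xt]; [by right|left].
  exists c => // j /=; rewrite mxE; have /andP[xl ->] := xc j; rewrite andbT.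
  by case: eqP => // ji; rewrite gt_max xl andbT ji.
apply: le_trans (leeD Xl Xr) _.
rewrite -esumD; [|by move=> *; exact: box_vol_ge0..].
apply: le_esum => c _; rewrite -EFinD lee_fin /box_vol.
rewrite (bigD1 i)//= [X in (_ + X <= _)%R](bigD1 i)//= [leRHS](bigD1 i)//=.
rewrite !mxE eqxx.
under eq_bigr => j /negbTE ji do rewrite !mxE ji.
under [X in (_ + _ * X <= _)%R]eq_bigr => j /negbTE ji do rewrite !mxE ji.
rewrite -mulrDl ler_wpM2r//; first by apply: prodr_ge0 => j _; rewrite le_max lexx.
rewrite /Num.min /Num.max.
by repeat case: ifPn; rewrite ?ltNge ?negbK; lra.
Qed.

End OuterMeasure.

(** * Volume of boxes and cubes *)
Section LebesgueRn.
Context (R : realType) (n : nat).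
Local Notation mu := (lebesgue R n).

Lemma measurable_coord (i : 'I_n) :
  measurable_fun [set: Rn R n] (fun x : Rn R n => (x : 'rV[R]_n) ord0 i).
Proof.
apply: (measurability _ (RGenInftyO.measurableE R)) => _ [_ [t ->] <-].
rewrite setTI; apply: measurable_halfspace.
Qed.

End LebesgueRn.

(** Countably many open boxes that cover a closed box have at least its volume.
    By induction on the dimension: the boxes whose first side contains t cover
    the slice at height t, so the volumes of their slices add up to at least that
    of the slice, and integrating over t with monotone convergence turns slice
    volumes into volumes.  The predicate P is what makes the induction go through, since it
    selects the boxes that meet a slice. *)
Lemma box_cover_vol (R : realType) (n : nat) (a b : 'I_n -> R)
    (P : pred nat) (u v : nat -> 'I_n -> R) :
  (forall i, a i <= b i) ->
  (forall x : 'I_n -> R, (forall i, a i <= x i <= b i) ->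
    exists2 k, P k & forall i, u k i < x i < v k i) ->
  ((\prod_i (b i - a i))%:E <=
    \sum_(k <oo) ((P k)%:R * \prod_i Num.max 0 (v k i - u k i))%:E)%E.
Proof.
have max0 (x : R) : 0 <= Num.max 0 x by rewrite le_max lexx.
elim: n a b P u v => [|n IH] a b P u v ab cover.
  have [|k Pk _] := cover (fun=> 0); first by case.
  rewrite big_ord0.
  apply: le_trans (nneseries_lim_ge k.+1 _); last first.
    by move=> j _ _; rewrite big_ord0 mulr1 lee_fin ler0n.
  rewrite big_nat_recr//= big_ord0 Pk mulr1 leeDr//.
  by apply: sume_ge0 => j _; rewrite big_ord0 mulr1 lee_fin ler0n.
pose W := \prod_(i < n) (b (lift ord0 i) - a (lift ord0 i)).
pose w k := (P k)%:R * \prod_(i < n) Num.max 0 (v k (lift ord0 i) - u k (lift ord0 i)).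
have w0 k : 0 <= w k by rewrite mulr_ge0// ?ler0n//; exact: prodr_ge0.
pose I k : set R := `]u k ord0, v k ord0[%classic.
pose D : set R := `[a ord0, b ord0]%classic.
pose nu := @lebesgue_measure R.
have slice t : D t -> (W%:E <= \sum_(k <oo) (w k * \1_(I k) t)%:E)%E.
  move=> Dt.
  have := IH (fun i => a (lift ord0 i)) (fun i => b (lift ord0 i))
    (fun k => P k && (t \in I k)) (fun k i => u k (lift ord0 i))
    (fun k i => v k (lift ord0 i)) (fun i => ab _).
  rewrite -/W.
  under eq_eseriesr => k _ do rewrite -mulnb natrM mulrAC -/(w k).
  apply => x xab.
  pose y i := if unlift ord0 i is Some j then x j else t.
  have [i|k Pk ky] := cover y.
    rewrite /y; case: unliftP => [j ->//|->].
    by move: Dt; rewrite /D /= in_itv.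
  exists k => [|i].
    rewrite Pk inE /I /= in_itv /=.
    by have := ky ord0; rewrite /y unlift_none.
  by have := ky (lift ord0 i); rewrite /y liftK.
have mD : measurable D by exact: measurable_itv.
have mI k : measurable (I k) by exact: measurable_itv.
rewrite big_ord_recl -/W.
have -> : ((b ord0 - a ord0) * W)%:E = (\int[nu]_(x in D) W%:E)%E.
  rewrite integral_cst//= /nu lebesgue_measure_itv/= lte_fin.
  rewrite EFinM muleC; congr (_ * _)%E.
  have := ab ord0; rewrite le_eqVlt => /predU1P[->|->].
    by rewrite ltxx subrr.
  by rewrite -EFinB.
have mwI k : measurable_fun D (fun t : R => (w k * \1_(I k) t)%:E).
  by apply/measurable_EFinP; apply: measurable_funM => //; apply: measurable_indic.
have wI0 k t : (0 <= (w k * \1_(I k) t)%:E)%E.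
  by rewrite lee_fin mulr_ge0// indicE ler0n.
apply: (@le_trans _ _ (\int[nu]_(t in D) (\sum_(k <oo) (w k * \1_(I k) t)%:E))%E).
  apply: ge0_le_integral => //.
  - by move=> t _; rewrite lee_fin; apply: prodr_ge0 => i _; rewrite subr_ge0.
  - exact: (ge0_emeasurable_sum (fun k t _ _ => wI0 k t) (fun k _ => mwI k)).
rewrite integral_nneseries//; apply: lee_nneseries => [k _ _|k _].
  by apply: integral_ge0 => t _.
under eq_integral do rewrite EFinM.
rewrite ge0_integralZl//; last 2 first.
- by apply/measurable_EFinP; apply: measurable_indic; exact: mI.
- by rewrite lee_fin.
rewrite integral_indic//=; last exact: mI.
have -> : (P k)%:R * \prod_(i < n.+1) Num.max 0 (v k i - u k i) =
    w k * Num.max 0 (v k ord0 - u k ord0).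
  by rewrite big_ord_recl mulrCA mulrC.
rewrite [leRHS]EFinM lee_wpmul2l ?lee_fin//.
apply: (@le_trans _ _ (nu (I k))).
  apply: le_measure; rewrite ?inE; [|exact: mI|exact: subIsetl].
  by apply: measurableI; [exact: mI|exact: mD].
rewrite /nu /I lebesgue_measure_itv/= lte_fin.
case: ltP => uv; last by rewrite lee_fin.
by rewrite -EFinB lee_fin le_max lexx orbT.
Qed.

(** The norm of 'rV[R]_n is the sup norm, whose balls are boxes; it is compared
    with the Euclidean norm of the difference quotients. *)
Section SupNorm.
Context (R : realType) (n : nat).
Implicit Types x y : 'rV[R]_n.

Lemma normr_coord_le x i : `|x ord0 i| <= `|x|.
Proof. by rewrite /Num.norm/= mx_normrE (le_bigmax _ _ (ord0, i)). Qed.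

Lemma mx_norm_le x r : 0 <= r -> (forall i, `|x ord0 i| <= r) -> `|x| <= r.
Proof.
move=> r0 xr; rewrite /Num.norm/= mx_normrE; apply: bigmax_le => //= -[i j] _ /=.
by rewrite ord1.
Qed.

Lemma mx_norm_lt x r : 0 < r -> (`|x| < r) = [forall i, `|x ord0 i| < r].
Proof.
move=> r0; apply/idP/forallP => [xr i|xr].
  exact: le_lt_trans (normr_coord_le x i) xr.
rewrite /Num.norm/= mx_normrE; apply/bigmax_ltP; split => //= -[i j] _ /=.
by rewrite ord1.
Qed.

Lemma normr_le_enorm x : `|x| <= enorm x.
Proof.
apply: mx_norm_le => [|i]; first exact: sqrtr_ge0.
rewrite -sqrtr_sqr ler_wsqrtr// (bigD1 i)//= lerDl.
by apply: sumr_ge0 => j _; exact: sqr_ge0.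
Qed.

Lemma enorm_le_normr x : enorm x <= Num.sqrt n%:R * `|x|.
Proof.
rewrite -[X in _ * X]normr_id -sqrtr_sqr -sqrtrM// ler_wsqrtr//.
apply: (@le_trans _ _ (\sum_(i < n) `|x| ^+ 2)).
  by apply: ler_sum => i _; rewrite -real_normK ?num_real// lerXn2r ?nnegrE// normr_coord_le.
by rewrite sumr_const card_ord mulr_natl.
Qed.


Lemma ball_box x r : 0 < r ->
  [set y | `|x - y| < r] = box (x - const_mx r, x + const_mx r).
Proof.
move=> r0; apply/seteqP; split=> y /=.
  rewrite mx_norm_lt// => /forallP xr i /=; have := xr i.
  by rewrite !mxE ltr_norml => /andP[? ?]; apply/andP; split; lra.
move=> yb; rewrite mx_norm_lt//; apply/forallP => i; have := yb i.
by rewrite /= !mxE ltr_norml => /andP[? ?]; apply/andP; split; lra.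
Qed.

End SupNorm.

Section CubeMeasure.
Context (R : realType) (n : nat).
Local Notation mu := (lebesgue_outer R n).

Definition cbox (a b : 'rV[R]_n) : set 'rV[R]_n :=
  [set x | forall i, a ord0 i <= x ord0 i <= b ord0 i].

Lemma box_vol_le_cbox (a b : 'rV[R]_n) : (forall i, a ord0 i <= b ord0 i) ->
  ((\prod_i (b ord0 i - a ord0 i))%:E <= mu (cbox a b))%E.
Proof.
move=> ab; apply: le_ereal_inf_tmp => _ [D [cD KD] <-].
have [g [P [gP ->]]] := countable_esumE R cD; last by move=> c; exact: box_vol_ge0.
have := @box_cover_vol R n (a ord0) (b ord0) P
  (fun k => (g k).1 ord0) (fun k => (g k).2 ord0) ab.
under eq_eseriesr do rewrite EFinM.
apply => x xab.
have [|c /gP[k Pk gk] xc] := KD (\row_i x i); first by move=> i; rewrite mxE.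
by exists k => // i; have := xc i; rewrite gk mxE.
Qed.

(** The faces of a box lie in hyperplanes. *)
Lemma lebesgue_outer_cboxD (a b : 'rV[R]_n) : mu (cbox a b `\` box (a, b)) = 0%E.
Proof.
pose F (k : nat) := if insub k is Some i
  then hyperplane i (a ord0 i) `|` hyperplane i (b ord0 i) else set0.
have sub : cbox a b `\` box (a, b) `<=` \bigcup_k F k.
  move=> x [xab /existsNP[i /negP xi]]; exists (val i) => //; rewrite /F valK.
  move: xi; rewrite /= negb_and -!leNgt; have /andP[ax xb] := xab i.
  by move=> /orP[xa|bx]; [left|right]; apply/eqP; rewrite eq_le ?xa ?ax ?bx ?xb.
apply/eqP; rewrite eq_le lebesgue_outer_ge0 andbT.
apply: le_trans (le_lebesgue_outer sub) _.
apply: le_trans (lebesgue_outer_countable _ _) _; first exact: countableP.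
rewrite esum1// => k _; rewrite /F; case: insub => [i|]; last exact: lebesgue_outer0.
apply/eqP; rewrite eq_le lebesgue_outer_ge0 andbT.
apply: le_trans (lebesgue_outer_subadditive _ _) _.
by rewrite !lebesgue_outer_hyperplane adde0.
Qed.

Lemma lebesgue_outer_cbox (a b : 'rV[R]_n) : (mu (cbox a b) <= mu (box (a, b)))%E.
Proof.
rewrite -[leRHS]adde0 -(lebesgue_outer_cboxD a b).
apply: le_trans (lebesgue_outer_subadditive _ _).
apply: le_lebesgue_outer => x xab.
by have [xb|xb] := pselect (box (a, b) x); [left|right].
Qed.

(** Whichever end points belong to its edges, a cube lies between an open and a
    closed one, which have the same measure. *)
Lemma cube_between (l : R) (Q : set 'rV[R]_n) : is_cube l Q ->
  exists a, box (a, a + const_mx l) `<=` Q /\ Q `<=` cbox a (a + const_mx l).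
Proof.
move=> [a [b [c ->]]]; exists a; split=> x xa i.
  have /= := xa i; rewrite !mxE => /andP[ax xb].
  rewrite in_itv/=; case: (b i) (c i) => -[] /=; rewrite ?ax ?xb ?(ltW ax) ?(ltW xb)//.
have := xa i; rewrite in_itv/= !mxE.
by case: (b i) (c i) => -[] /= /andP[ax xb]; rewrite ?ax ?xb ?(ltW ax) ?(ltW xb).
Qed.

Lemma box_vol_cube (a : 'rV[R]_n) (l : R) : 0 <= l ->
  box_vol (a, a + const_mx l) = l ^+ n.
Proof.
move=> l0; rewrite /box_vol/=.
under eq_bigr do rewrite !mxE addrAC subrr add0r max_r//.
by rewrite prodr_const card_ord.
Qed.

Lemma lebesgue_outer_between (a : 'rV[R]_n) (l : R) (Q : set 'rV[R]_n) : 0 <= l ->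
  box (a, a + const_mx l) `<=` Q -> Q `<=` cbox a (a + const_mx l) ->
  mu Q = (l ^+ n)%:E.
Proof.
move=> l0 bQ Qb; apply/eqP; rewrite eq_le; apply/andP; split.
  apply: le_trans (le_lebesgue_outer Qb) _.
  apply: le_trans (lebesgue_outer_cbox _ _) _.
  by apply: le_trans (lebesgue_outer_box _) _; rewrite box_vol_cube.
apply: le_trans (le_lebesgue_outer bQ).
apply: le_trans (lebesgue_outer_cbox _ _).
have -> : l ^+ n = \prod_i ((a + const_mx l) ord0 i - a ord0 i).
  rewrite -[in LHS](card_ord n) -prodr_const; apply: eq_bigr => i _.
  by rewrite !mxE addrAC subrr add0r.
by apply: box_vol_le_cbox => i; rewrite !mxE lerDl.
Qed.

Lemma lebesgue_cube (l : R) (Q : set 'rV[R]_n) : 0 <= l -> is_cube l Q ->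
  mu Q = (l ^+ n)%:E.
Proof. by move=> l0 /cube_between[a [bQ Qb]]; exact: lebesgue_outer_between bQ Qb. Qed.

Lemma measurable_coords (A : 'I_n -> set R) : (forall i, measurable (A i)) ->
  measurable ([set x : 'rV[R]_n | forall i, A i (x ord0 i)] : set (Rn R n)).
Proof.
move=> mA.
have -> : [set x : 'rV[R]_n | forall i, A i (x ord0 i)] =
    \bigcap_(i in [set: 'I_n]) ((fun x : 'rV[R]_n => x ord0 i) @^-1` A i).
  by apply/seteqP; split=> [x xA i _|x xA i]; [exact: xA|exact: xA].
apply: (@fin_bigcap_measurable _ (Rn R n)) => // i _.
by rewrite -[X in measurable X]setTI; exact: (measurable_coord i).
Qed.

Lemma measurable_cube (l : R) (Q : set (Rn R n)) : is_cube l Q -> measurable Q.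
Proof.
move=> [a [b [c ->]]].
exact: (@measurable_coords (fun i => [set` Interval _ _])).
Qed.

Lemma measurable_box (c : 'rV[R]_n * 'rV[R]_n) : measurable (box c : set (Rn R n)).
Proof.
rewrite (_ : box c = [set x | forall i, [set` `]c.1 ord0 i, c.2 ord0 i[] (x ord0 i)]).
  exact: (@measurable_coords (fun i => [set` Interval _ _])).
by apply/seteqP; split=> x xc i; have := xc i; rewrite /= in_itv.
Qed.

Lemma sigma_finite_lebesgue : sigma_finite [set: Rn R n] (lebesgue R n).
Proof.
exists (fun k => box (const_mx (- k%:R), const_mx k%:R)).
  apply/esym/seteqP; split=> // x _.
  exists (Num.bound `|x : 'rV[R]_n|) => // i /=.
  rewrite !mxE -ltr_norml.
  exact: le_lt_trans (normr_coord_le _ _) (archi_boundP _).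
move=> k; split; first exact: measurable_box.
exact: le_lt_trans (lebesgue_outer_box _) (ltry _).
Qed.

HB.instance Definition _ := @Measure_isSigmaFinite.Build _ _ _ (lebesgue R n)
  sigma_finite_lebesgue.

End CubeMeasure.

(** * Iterated integrals over a square *)
Section DoubleIntegral.
Context d (T : measurableType d) (R : realType).
Variable m : {sigma_finite_measure set T -> \bar R}.
Local Open Scope ereal_scope.
Implicit Types G : T * T -> \bar R.

Lemma measurable_inner_integral G (Q : set T) : measurable Q ->
  measurable_fun setT G -> (forall z, 0 <= G z) ->
  measurable_fun setT (fun x => \int[m]_(y in Q) G (x, y)).
Proof.
move=> mQ mG G0.
pose H z := G z * (\1_Q z.2)%:E.
have -> : (fun x => \int[m]_(y in Q) G (x, y)) = fubini_F m H.
  apply/funext => x; rewrite /fubini_F [LHS]integral_mkcond.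
  apply: eq_integral => y _; rewrite patchE /H /= indicE.
  by case: ifP => _; rewrite ?mule1 ?mule0.
apply: measurable_fun_fubini_tonelli_F => [|z]; last first.
  by rewrite /H mule_ge0// indicE lee_fin ler0n.
apply: emeasurable_funM => //; apply/measurable_EFinP.
by apply: measurableT_comp => //; exact: measurable_indic.
Qed.

Lemma measurable_section1 G x : measurable_fun setT G ->
  measurable_fun setT (fun y => G (x, y)).
Proof. by move=> mG; apply: measurableT_comp => //; exact: measurable_pair1. Qed.

Lemma ae_le_double_integral G1 G2 (Q : set T) : measurable Q ->
  measurable_fun setT G1 -> (forall z, 0 <= G1 z) ->
  measurable_fun setT G2 -> (forall z, 0 <= G2 z) ->
  {ae m, forall x, Q x -> {ae m, forall y, Q y -> G1 (x, y) <= G2 (x, y)}} ->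
  \int[m]_(x in Q) \int[m]_(y in Q) G1 (x, y) <=
  \int[m]_(x in Q) \int[m]_(y in Q) G2 (x, y).
Proof.
move=> mQ mG1 G10 mG2 G20 G12; apply: ae_ge0_le_integral => //.
- by move=> x _; exact: integral_ge0.
- by apply: measurable_funTS; exact: measurable_inner_integral.
- by move=> x _; exact: integral_ge0.
- by apply: measurable_funTS; exact: measurable_inner_integral.
apply: filterS G12 => x G12 Qx; apply: ae_ge0_le_integral => //.
- by apply: measurable_funTS; exact: measurable_section1.
- by apply: measurable_funTS; exact: measurable_section1.
- exact: G12.
Qed.

Lemma le_double_integral G1 G2 (Q : set T) : measurable Q ->
  measurable_fun setT G1 -> (forall z, 0 <= G1 z) ->
  measurable_fun setT G2 -> (forall z, 0 <= G2 z) ->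
  (forall x y, Q x -> Q y -> G1 (x, y) <= G2 (x, y)) ->
  \int[m]_(x in Q) \int[m]_(y in Q) G1 (x, y) <=
  \int[m]_(x in Q) \int[m]_(y in Q) G2 (x, y).
Proof.
move=> mQ mG1 G10 mG2 G20 G12; apply: ae_le_double_integral => //.
by apply: aeW => x Qx; apply: aeW => y Qy; exact: G12.
Qed.

Lemma double_integralD G1 G2 (Q : set T) : measurable Q ->
  measurable_fun setT G1 -> (forall z, 0 <= G1 z) ->
  measurable_fun setT G2 -> (forall z, 0 <= G2 z) ->
  \int[m]_(x in Q) \int[m]_(y in Q) (G1 (x, y) + G2 (x, y)) =
  \int[m]_(x in Q) \int[m]_(y in Q) G1 (x, y) +
  \int[m]_(x in Q) \int[m]_(y in Q) G2 (x, y).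
Proof.
move=> mQ mG1 G10 mG2 G20.
have I0 G : (forall z, 0 <= G z) -> forall x, Q x -> 0 <= \int[m]_(y in Q) G (x, y).
  by move=> G0 x _; exact: integral_ge0.
have mI G : measurable_fun setT G -> (forall z, 0 <= G z) ->
    measurable_fun Q (fun x => \int[m]_(y in Q) G (x, y)).
  by move=> mG G0; apply: measurable_funTS; exact: measurable_inner_integral.
rewrite -(ge0_integralD m mQ (I0 _ G10) (mI _ mG1 G10) (I0 _ G20) (mI _ mG2 G20)).
apply: eq_integral => x _; rewrite ge0_integralD//.
- exact: (measurable_funTS (measurable_section1 x mG1)).
- exact: (measurable_funTS (measurable_section1 x mG2)).
Qed.

Lemma double_integralZl G (Q : set T) (k : R) : measurable Q ->
  measurable_fun setT G -> (forall z, 0 <= G z) -> (0 <= k)%R ->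
  \int[m]_(x in Q) \int[m]_(y in Q) (k%:E * G (x, y)) =
  k%:E * \int[m]_(x in Q) \int[m]_(y in Q) G (x, y).
Proof.
move=> mQ mG G0 k0.
have mI : measurable_fun Q (fun x => \int[m]_(y in Q) G (x, y)).
  by apply: measurable_funTS; exact: measurable_inner_integral.
rewrite -(ge0_integralZl m mQ mI)//; last by move=> x _; exact: integral_ge0.
apply: eq_integral => x _; rewrite ge0_integralZl//.
exact: (measurable_funTS (measurable_section1 x mG)).
Qed.

(** Tonelli's theorem, transported from the whole space to Q by the indicator of
    Q in both variables. *)
Lemma double_integral_swap G (Q : set T) : measurable Q ->
  measurable_fun setT G -> (forall z, 0 <= G z) ->
  \int[m]_(x in Q) \int[m]_(y in Q) G (x, y) =
  \int[m]_(x in Q) \int[m]_(y in Q) G (y, x).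
Proof.
move=> mQ mG G0.
pose H z := G z * (\1_Q z.1 * \1_Q z.2)%:E.
have H0 z : 0 <= H z by rewrite /H mule_ge0// !indicE lee_fin mulr_ge0.
have mH : measurable_fun setT H.
  apply: emeasurable_funM => //; apply/measurable_EFinP.
  by apply: measurable_funM; apply: measurableT_comp => //; exact: measurable_indic.
transitivity (\int[m]_x \int[m]_y H (x, y)).
  rewrite [LHS]integral_mkcond; apply: eq_integral => x _.
  rewrite patchE; case: ifPn => xQ.
    rewrite [LHS]integral_mkcond; apply: eq_integral => y _; rewrite patchE /H /=.
    by rewrite !indicE xQ mul1r; case: ifP => _; rewrite ?mule1 ?mule0.
  rewrite integral0_eq// => y _; rewrite /H /= !indicE (negbTE xQ).
  by rewrite mul0r mule0.
rewrite (fubini_tonelli H)//.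
rewrite [RHS]integral_mkcond; apply: eq_integral => x _.
rewrite patchE; case: ifPn => xQ.
  rewrite [RHS]integral_mkcond; apply: eq_integral => y _; rewrite patchE /H /=.
  by rewrite !indicE xQ mulr1; case: ifP => _; rewrite ?mule1 ?mule0.
rewrite integral0_eq// => y _; rewrite /H /= !indicE (negbTE xQ).
by rewrite mulr0 mule0.
Qed.

End DoubleIntegral.

(** * Difference quotients, oscillations and the JNQ norm *)
Section QuasiTriangle.
Context (R : realType).
Local Open Scope ereal_scope.

Lemma poweR_add_le (x y : \bar R) (r : R) : (0 <= r)%R -> 0 <= x -> 0 <= y ->
  (x + y) `^ r <= (2 `^ r)%:E * (x `^ r + y `^ r).
Proof.
move=> r0 x0 y0; have xy0 : 0 <= maxe x y by rewrite le_max x0.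
apply: (@le_trans _ _ ((2%:E * maxe x y) `^ r)).
  apply: gt0_ler_poweR => //; rewrite ?in_itv/= ?leey ?andbT ?adde_ge0 ?mule_ge0 ?lee_fin//.
  by rewrite mule_natl mule2n leeD// le_max lexx ?orbT.
rewrite poweRM ?lee_fin// poweR_EFin lee_wpmul2l ?lee_fin ?powR_ge0//.
by case: (leP x y) => _; rewrite ?leeDl ?leeDr ?poweR_ge0.
Qed.

Lemma esum_mul_le (T : choiceType) (D : set T) (F : T -> \bar R) (c : R) :
  (0 <= c)%R -> (forall i, 0 <= F i) ->
  \esum_(i in D) (c%:E * F i) <= c%:E * \esum_(i in D) F i.
Proof.
move=> c0 F0; apply: ge_ereal_sup => _ [X [finX XD] <-].
rewrite -ge0_mule_fsumr// lee_wpmul2l ?lee_fin//.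
by apply: ereal_sup_ubound; exists X.
Qed.

End QuasiTriangle.

Section Oscillation.
Context (R : realType) (n : nat) (alpha p q : R).
Hypothesis q1 : 1 <= q.
Hypothesis p1 : 1 <= p.
Implicit Types f g h k : 'rV[R]_n -> R.
Local Notation mu := (lebesgue R n).

Definition diff_quotient f (z : Rn R n * Rn R n) : \bar R :=
  (`|f z.1 - f z.2| `^ q / enorm ((z.1 : 'rV[R]_n) - z.2) `^ (n%:R + q * alpha))%:E.

Lemma diff_quotient_ge0 f z : (0 <= diff_quotient f z)%E.
Proof. by rewrite lee_fin divr_ge0 ?powR_ge0. Qed.

Lemma measurable_enormB :
  measurable_fun setT (fun z : Rn R n * Rn R n => enorm ((z.1 : 'rV[R]_n) - z.2)).
Proof.
rewrite /enorm; apply: measurableT_comp.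
  by apply: continuous_measurable_fun; exact: sqrt_continuous.
apply: measurable_sum => i; apply: measurable_funX.
rewrite (_ : (fun _ => _) = (fun z : Rn R n * Rn R n =>
    (z.1 : 'rV[R]_n) ord0 i - (z.2 : 'rV[R]_n) ord0 i)); last first.
  by apply/funext => z; rewrite !mxE.
apply: measurable_funB.
  by apply: (measurableT_comp (measurable_coord i)); exact: measurable_fst.
by apply: (measurableT_comp (measurable_coord i)); exact: measurable_snd.
Qed.

Lemma measurable_diff_quotient f : lebesgue_measurable_fun f ->
  measurable_fun setT (diff_quotient f).
Proof.
move=> mf; apply/measurable_EFinP.
apply: measurable_funM.
  apply: (measurableT_comp (measurable_powR q)).
  apply: (measurableT_comp (@normr_measurable _ setT)).
  by apply: measurable_funB; apply: (measurableT_comp mf).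
rewrite (_ : (fun _ => _) = (fun z : Rn R n * Rn R n =>
    enorm ((z.1 : 'rV[R]_n) - z.2) `^ (- (n%:R + q * alpha)))); last first.
  by apply/funext => z; rewrite powRN.
exact: (measurableT_comp (measurable_powR _) measurable_enormB).
Qed.

Lemma oscillationE f (Q : set (Rn R n)) : oscillation alpha q f Q =
  (mu Q `^ (q * alpha / n%:R - 1) *
   \int[mu]_(x in Q) \int[mu]_(y in Q) diff_quotient f (x, y))%E.
Proof. by []. Qed.

Lemma oscillation_ge0 f Q : (0 <= oscillation alpha q f Q)%E.
Proof.
rewrite mule_ge0 ?poweR_ge0//; apply: integral_ge0 => x _.
by apply: integral_ge0 => y _; exact: (diff_quotient_ge0 f (x, y)).
Qed.

Lemma oscillation_lipschitz f h (K : R) (Q : set (Rn R n)) : measurable Q ->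
  lebesgue_measurable_fun f -> lebesgue_measurable_fun h -> 0 <= K ->
  (forall x y, `|h x - h y| <= K * `|f x - f y|) ->
  (oscillation alpha q h Q <= (K `^ q)%:E * oscillation alpha q f Q)%E.
Proof.
move=> mQ mf mh K0 hf; have q0 : 0 <= q by exact: le_trans ler01 q1.
rewrite !oscillationE muleCA lee_wpmul2l ?poweR_ge0//.
rewrite -(double_integralZl mu mQ (measurable_diff_quotient mf))//; last 2 first.
- exact: diff_quotient_ge0.
- exact: powR_ge0.
apply: (@le_double_integral _ _ _ mu (diff_quotient h)
  (fun z => (K `^ q)%:E * diff_quotient f z)%E Q mQ) => //.
- exact: measurable_diff_quotient.
- exact: diff_quotient_ge0.
- by apply: measurable_funeM; exact: measurable_diff_quotient.
- by move=> z; rewrite mule_ge0 ?diff_quotient_ge0// lee_fin powR_ge0.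
move=> x y _ _; rewrite /diff_quotient/= -EFinM lee_fin mulrA.
rewrite ler_wpM2r ?invr_ge0 ?powR_ge0// -powRM//.
by apply: ge0_ler_powR; rewrite ?nnegrE ?mulr_ge0.
Qed.

(** Inequalities that fail on a null set survive in both integrals because the
    inner integral is measurable in x. *)
Lemma oscillation_sub f g k (Q : set (Rn R n)) : measurable Q ->
  lebesgue_measurable_fun f -> lebesgue_measurable_fun g ->
  lebesgue_measurable_fun k -> {ae mu, forall x, f x = g x - k x} ->
  (oscillation alpha q f Q <=
   (2 `^ q)%:E * (oscillation alpha q g Q + oscillation alpha q k Q))%E.
Proof.
move=> mQ mf mg mk fgk; have q0 : 0 <= q by exact: le_trans ler01 q1.
have D0 := diff_quotient_ge0; have mD := measurable_diff_quotient.
have I0 h : (0 <= \int[mu]_(x in Q) \int[mu]_(y in Q) diff_quotient h (x, y))%E.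
  apply: integral_ge0 => x _; apply: integral_ge0 => y _; exact: (D0 h (x, y)).
rewrite !oscillationE -(ge0_muleDr _ (I0 g) (I0 k)).
rewrite muleCA lee_wpmul2l ?poweR_ge0//.
rewrite -(double_integralD mu mQ (mD _ mg) (D0 g) (mD _ mk) (D0 k)).
have D2 z : (0 <= diff_quotient g z + diff_quotient k z)%E by rewrite adde_ge0.
have mD2 : measurable_fun setT (fun z => diff_quotient g z + diff_quotient k z)%E.
  by apply: emeasurable_funD; exact: mD.
rewrite -(double_integralZl mu mQ mD2 D2 (powR_ge0 _ _)).
apply: (@ae_le_double_integral _ _ _ mu (diff_quotient f)
  (fun z => (2 `^ q)%:E * (diff_quotient g z + diff_quotient k z))%E Q mQ) => //.
- exact: mD.
- exact: measurable_funeM.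
- by move=> z; rewrite mule_ge0// lee_fin powR_ge0.
have aeF : Filter (almost_everywhere mu).
  exact: (@ae_filter_ringOfSetsType _ _ _ mu).
apply: (@filterS _ _ aeF _ _ _ fgk) => x fx _.
apply: (@filterS _ _ aeF _ _ _ fgk) => y fy _.
rewrite /diff_quotient/= -EFinD -EFinM lee_fin -mulrDl mulrA.
rewrite ler_wpM2r ?invr_ge0 ?powR_ge0//.
apply: (@le_trans _ _ ((`|g x - g y| + `|k x - k y|) `^ q)).
  apply: ge0_ler_powR; rewrite ?nnegrE// fx fy.
  rewrite (_ : _ - _ = (g x - g y) - (k x - k y)); first exact: ler_normB.
  by ring.
have := @poweR_add_le R `|g x - g y|%:E `|k x - k y|%:E q q0.
by rewrite -EFinD !poweR_EFin -EFinD -EFinM !lee_fin; apply.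
Qed.

Definition JNQ_sum f (P : set (set 'rV[R]_n)) : \bar R :=
  (\esum_(Q in P) (mu Q * oscillation alpha q f Q `^ (p / q)))%E.

Lemma JNQ_sum_ge0 f P : (0 <= JNQ_sum f P)%E.
Proof.
by apply: esum_ge0 => Q _; rewrite mule_ge0 ?poweR_ge0//; exact: lebesgue_outer_ge0.
Qed.

(** Removes the outer power 1/p, so that finiteness can be checked on sums. *)
Lemma JNQ_norm_ltyP f : (JNQ_norm alpha p q f < +oo)%E <->
  exists M : R, forall l P, 0 < l -> cube_collection l P -> (JNQ_sum f P <= M%:E)%E.
Proof.
have p0 : 0 < p by exact: lt_le_trans ltr01 p1.
split=> [flty|[M fM]].
  have f0 : (0 <= JNQ_norm alpha p q f)%E.
    apply: (@le_trans _ _ (0 `^ p^-1)%E); first exact: poweR_ge0.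
    apply: ereal_sup_ubound; exists 1, set0; split=> //; last by rewrite esum_set0.
    by split.
  exists (fine (JNQ_norm alpha p q f `^ p)%E) => l P l0 cP.
  rewrite fineK; last by rewrite ge0_fin_numE ?poweR_ge0// poweR_lty.
  rewrite -[leLHS]poweRe1 ?JNQ_sum_ge0// -(mulVf (lt0r_neq0 p0)) poweRrM.
  apply: gt0_ler_poweR; rewrite ?in_itv/= ?leey ?andbT ?poweR_ge0 ?(ltW p0)//.
  by apply: ereal_sup_ubound; exists l, P.
apply: (@le_lt_trans _ _ (`|M|%:E `^ p^-1)%E); last by rewrite poweR_EFin ltry.
apply: ge_ereal_sup => _ [l [P [l0 cP ->]]].
apply: gt0_ler_poweR; rewrite ?in_itv/= ?leey ?andbT ?invr_ge0 ?(ltW p0)//.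
- exact: JNQ_sum_ge0.
by apply: le_trans (fM l P l0 cP) _; rewrite lee_fin ler_norm.
Qed.

Lemma JNQ_norm_lipschitz f h (K : R) :
  lebesgue_measurable_fun f -> lebesgue_measurable_fun h -> 0 < K ->
  (forall x y, `|h x - h y| <= K * `|f x - f y|) ->
  (JNQ_norm alpha p q h <= K%:E * JNQ_norm alpha p q f)%E.
Proof.
move=> mf mh K0 hf; have p0 : 0 < p by exact: lt_le_trans ltr01 p1.
have q0 : 0 < q by exact: lt_le_trans ltr01 q1.
have pq0 : 0 <= p / q by rewrite divr_ge0 ?ltW.
apply: ge_ereal_sup => _ [l [P [l0 [cP tP] ->]]].
apply: (@le_trans _ _ (((K `^ p)%:E * JNQ_sum f P) `^ p^-1)%E).
  apply: gt0_ler_poweR; rewrite ?in_itv/= ?leey ?andbT ?invr_ge0 ?(ltW p0)//.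
  - exact: JNQ_sum_ge0.
  - by rewrite mule_ge0 ?JNQ_sum_ge0// lee_fin powR_ge0.
  apply: le_trans (esum_mul_le _ _ _); last 2 first.
  - exact: powR_ge0.
  - by move=> Q; rewrite mule_ge0 ?poweR_ge0//; exact: lebesgue_outer_ge0.
  apply: le_esum => Q PQ; rewrite [leRHS]muleCA lee_wpmul2l//.
  have mQ := measurable_cube (cP _ PQ).
  have -> : (K `^ p)%:E = ((K `^ q)%:E `^ (p / q))%E.
    by rewrite poweR_EFin -powRrM mulrC divfK// gt_eqF.
  rewrite -poweRM ?oscillation_ge0 ?lee_fin ?powR_ge0//.
  apply: gt0_ler_poweR; rewrite ?in_itv/= ?leey ?andbT ?oscillation_ge0//.
    by rewrite mule_ge0 ?oscillation_ge0// lee_fin powR_ge0.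
  by apply: oscillation_lipschitz => //; rewrite ltW.
rewrite poweRM ?JNQ_sum_ge0 ?lee_fin ?powR_ge0// poweR_EFin -powRrM.
rewrite divff ?gt_eqF// powRr1 ?(ltW K0)// lee_wpmul2l ?lee_fin ?(ltW K0)//.
by apply: ereal_sup_ubound; exists l, P.
Qed.

Lemma JNQ_norm_sub f g k :
  lebesgue_measurable_fun f -> lebesgue_measurable_fun g ->
  lebesgue_measurable_fun k -> {ae mu, forall x, f x = g x - k x} ->
  (JNQ_norm alpha p q g < +oo)%E -> (JNQ_norm alpha p q k < +oo)%E ->
  (JNQ_norm alpha p q f < +oo)%E.
Proof.
move=> mf mg mk fgk /JNQ_norm_ltyP[Mg gM] /JNQ_norm_ltyP[Mk kM].
have p0 : 0 < p by exact: lt_le_trans ltr01 p1.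
have q0 : 0 < q by exact: lt_le_trans ltr01 q1.
have pq0 : 0 <= p / q by rewrite divr_ge0 ?ltW.
pose c : R := (2 `^ q) `^ (p / q) * 2 `^ (p / q).
have c0 : 0 <= c by rewrite mulr_ge0 ?powR_ge0.
apply/JNQ_norm_ltyP; exists (c * (Mg + Mk)) => l P l0 cP.
pose T h (Q : set 'rV[R]_n) := (mu Q * oscillation alpha q h Q `^ (p / q))%E.
have T0 h Q : (0 <= T h Q)%E.
  by rewrite mule_ge0 ?poweR_ge0//; exact: lebesgue_outer_ge0.
apply: (@le_trans _ _ (\esum_(Q in P) (c%:E * (T g Q + T k Q)))%E); last first.
  have T2 Q : (0 <= T g Q + T k Q)%E by rewrite adde_ge0.
  apply: le_trans (esum_mul_le _ c0 T2) _.
  rewrite [leRHS]EFinM lee_wpmul2l ?lee_fin// esumD// EFinD leeD//.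
    exact: (gM l).
  exact: (kM l).
apply: le_esum => Q PQ; have mQ := measurable_cube (cP.1 _ PQ).
rewrite -ge0_muleDr ?poweR_ge0// [leRHS]muleCA lee_wpmul2l//.
have O2 : (0 <= oscillation alpha q g Q + oscillation alpha q k Q)%E.
  by rewrite adde_ge0// oscillation_ge0.
apply: (@le_trans _ _ (((2 `^ q)%:E *
    (oscillation alpha q g Q + oscillation alpha q k Q)) `^ (p / q))%E).
  apply: gt0_ler_poweR; rewrite ?in_itv/= ?leey ?andbT ?oscillation_ge0//.
    by rewrite mule_ge0// lee_fin powR_ge0.
  exact: oscillation_sub.
rewrite poweRM ?lee_fin ?powR_ge0// poweR_EFin /c EFinM -muleA.
rewrite lee_wpmul2l ?lee_fin ?powR_ge0//.
by apply: poweR_add_le => //; exact: oscillation_ge0.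
Qed.

End Oscillation.

(** * Integrals of the kernel |x - y| ^ (q - n - q alpha) *)
Section RieszKernel.
Context (R : realType).

(** Covers both signs of e, hence a power that is increasing or decreasing. *)
Lemma powR_between (a u b e : R) : 0 < a -> a <= u -> u <= b ->
  u `^ e <= a `^ e + b `^ e.
Proof.
move=> a0 au ub; have u0 : 0 < u by exact: lt_le_trans au.
have b0 : 0 < b by exact: lt_le_trans ub.
have [e0|/ltW e0] := leP 0 e.
  apply: (@le_trans _ _ (b `^ e)); last by rewrite lerDr powR_ge0.
  by apply: ge0_ler_powR; rewrite ?nnegrE ?(ltW u0) ?(ltW b0).
apply: (@le_trans _ _ (a `^ e)); last by rewrite lerDl powR_ge0.
rewrite -[e]opprK !(powRN _ (- e)) lef_pV2 ?posrE ?powR_gt0//.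
by apply: ge0_ler_powR; rewrite ?nnegrE ?oppr_ge0 ?(ltW a0) ?(ltW u0).
Qed.

Lemma dyadic_scale (l r : R) : 0 < r -> r <= l ->
  exists k : nat, 2^-1 ^+ k.+1 * l < r <= 2^-1 ^+ k * l.
Proof.
move=> r0 rl; have l0 : 0 < l by exact: lt_le_trans rl.
have ex : exists k, 2^-1 ^+ k * l < r.
  exists (Num.bound (l / r)); rewrite exprVn mulrC ltr_pdivrMr ?exprn_gt0//.
  rewrite -ltr_pdivrMl// mulrC.
  apply: lt_trans (archi_boundP _) _; first by rewrite divr_ge0 ?ltW.
  by rewrite -natrX ltr_nat ltn_expl.
case: (ex_minnP ex) => -[|k].
  by rewrite expr0 mul1r ltNge rl.
move=> kr kmin; exists k; rewrite kr/= leNgt; apply/negP => /kmin.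
by rewrite ltnn.
Qed.

Lemma nneseries_ge_term (u : nat -> \bar R) k : (forall j, (0 <= u j)%E) ->
  (u k <= \sum_(j <oo) u j)%E.
Proof.
move=> u0; apply: le_trans (nneseries_lim_ge k.+1 _) => //.
by rewrite big_nat_recr//= leeDr// sume_ge0.
Qed.

Lemma nneseries_geometric_le (c z : R) : 0 <= c -> 0 <= z < 1 ->
  (\sum_(k <oo) (c * z ^+ k)%:E <= (c / (1 - z))%:E)%E.
Proof.
move=> c0 /andP[z0 z1].
apply: lime_le.
  by apply: is_cvg_nneseries => k _ _; rewrite lee_fin mulr_ge0 ?exprn_ge0.
apply: nearW => N; rewrite sumEFin lee_fin -mulr_sumr ler_wpM2l//.
have z1' : 0 < 1 - z by rewrite subr_gt0.
rewrite -[leRHS]mul1r ler_pdivlMr// big_mkord mulrC.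
by rewrite -opprB mulNr -subrX1 opprB lerBlDr lerDl exprn_ge0.
Qed.

Context (n : nat) (alpha q : R).
Hypotheses (q1 : 1 <= q) (alpha1 : alpha < 1).
Local Notation mu := (lebesgue R n).

(** The difference quotient of a function for which |f x - f y| is the Euclidean
    distance.  Keeping it as a quotient gives it the value 0 on the diagonal,
    whatever the sign of the exponent. *)
Definition riesz_kernel (z : Rn R n * Rn R n) : \bar R :=
  (enorm ((z.1 : 'rV[R]_n) - z.2) `^ q /
   enorm ((z.1 : 'rV[R]_n) - z.2) `^ (n%:R + q * alpha))%:E.

Lemma riesz_kernel_ge0 z : (0 <= riesz_kernel z)%E.
Proof. by rewrite lee_fin divr_ge0 ?powR_ge0. Qed.

Lemma riesz_kernelC x y : riesz_kernel (x, y) = riesz_kernel (y, x).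
Proof.
rewrite /riesz_kernel /= (_ : enorm _ = enorm ((y : 'rV[R]_n) - x))//.
by congr Num.sqrt; apply: eq_bigr => i _; rewrite !mxE -sqrrN opprB.
Qed.

Lemma measurable_riesz_kernel : measurable_fun setT riesz_kernel.
Proof.
apply/measurable_EFinP; apply: measurable_funM.
  exact: (measurableT_comp (measurable_powR _) (@measurable_enormB _ _)).
rewrite (_ : (fun _ => _) = (fun z : Rn R n * Rn R n =>
    enorm ((z.1 : 'rV[R]_n) - z.2) `^ (- (n%:R + q * alpha)))); last first.
  by apply/funext => z; rewrite powRN.
exact: (measurableT_comp (measurable_powR _) (@measurable_enormB _ _)).
Qed.

Let e := q - (n%:R + q * alpha).
Let t := q * (1 - alpha).
Let C0 := 2^-1 `^ e + Num.sqrt n%:R `^ e.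
Let shell (x : 'rV[R]_n) (l : R) k : set (Rn R n) :=
  [set y : 'rV[R]_n | `|x - y| < 2 * (2^-1 ^+ k * l)].

(** On the shell where |x - y| lies between a/2 and a, with a = l / 2 ^ k, the
    Euclidean norm is comparable with a, so the kernel is at most C0 a ^ e. *)
Lemma riesz_kernel_le_shells (l : R) (x y : Rn R n) : 0 < l ->
  `|(x : 'rV[R]_n) - y| <= l ->
  (riesz_kernel (x, y) <=
   \sum_(k <oo) (C0 * (2^-1 ^+ k * l) `^ e * \1_(shell x l k) y)%:E)%E.
Proof.
move=> l0 xyl; have q0 : 0 < q by exact: lt_le_trans q1.
have C00 : 0 <= C0 by rewrite addr_ge0 ?powR_ge0.
have s0 k : (0 <= (C0 * (2^-1 ^+ k * l) `^ e * \1_(shell x l k) y)%:E)%E.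
  by rewrite lee_fin mulr_ge0// ?mulr_ge0 ?powR_ge0// indicE ler0n.
have [xy|xy] := eqVneq `|x - y| 0.
  have en0 : enorm (x - y) = 0.
    apply/eqP; rewrite eq_le sqrtr_ge0 andbT.
    by apply: le_trans (enorm_le_normr _) _; rewrite xy mulr0.
  by rewrite /riesz_kernel/= en0 powR0 ?gt_eqF// mul0r; apply: nneseries_ge0.
have r0 : 0 < `|x - y| by rewrite lt_neqAle eq_sym xy normr_ge0.
have [k /andP[kr rk]] := dyadic_scale r0 xyl.
apply: le_trans (nneseries_ge_term k s0); rewrite /riesz_kernel/= lee_fin.
set a := 2^-1 ^+ k * l in rk *.
have a0 : 0 < a by rewrite mulr_gt0// exprn_gt0// invr_gt0.
rewrite indicE mem_set ?mulr1; last first.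
  by rewrite /shell/= -/a; apply: le_lt_trans rk _; rewrite ltr_pMl// ltr1n.
have en0 : 0 < enorm (x - y) by exact: lt_le_trans (normr_le_enorm _).
rewrite -powRB; last by rewrite (gt_eqF en0) implybT.
rewrite -/e -[enorm (x - y)](divfK (lt0r_neq0 a0)) powRM ?divr_ge0 ?(ltW a0) ?(ltW en0)//.

rewrite ler_wpM2r ?powR_ge0// powR_between ?invr_gt0//.
  rewrite ler_pdivlMr//; apply: le_trans (normr_le_enorm _).
  by apply: ltW; rewrite /a mulrA -exprS.
rewrite ler_pdivrMr//; apply: le_trans (enorm_le_normr _) _.
by rewrite ler_wpM2l// sqrtr_ge0.
Qed.

Lemma measurable_shell x l k : 0 < l -> measurable (shell x l k).
Proof.
move=> l0; rewrite /shell ball_box; first exact: measurable_box.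
by rewrite mulr_gt0// mulr_gt0// exprn_gt0// invr_gt0.
Qed.

Lemma lebesgue_shell x l k : 0 < l ->
  (mu (shell x l k) <= ((4 * (2^-1 ^+ k * l)) ^+ n)%:E)%E.
Proof.
move=> l0; set a := 2^-1 ^+ k * l.
have a0 : 0 < a by rewrite mulr_gt0// exprn_gt0// invr_gt0.
rewrite /shell ball_box; last by rewrite mulr_gt0.
apply: le_trans (lebesgue_outer_box _) _; rewrite lee_fin /box_vol.
under eq_bigr => i _.
  rewrite /= !mxE (_ : _ - _ = 4 * a); last by rewrite -/a; ring.
  rewrite max_r; last by rewrite mulr_ge0// ltW.
  over.
by rewrite prodr_const card_ord.
Qed.

(** The k-th shell contributes a multiple of (l / 2 ^ k) ^ (e + n), and
    e + n = t > 0 because alpha < 1: a geometric series of ratio 2 ^ - t. *)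
Lemma riesz_kernel_integral_le : exists2 C : R, 0 < C &
  forall (l : R) (x : Rn R n) (Q : set (Rn R n)), 0 < l -> measurable Q ->
  (forall y, Q y -> `|(x : 'rV[R]_n) - y| <= l) ->
  (\int[mu]_(y in Q) riesz_kernel (x, y) <= (C * l `^ t)%:E)%E.
Proof.
have q0 : 0 < q by exact: lt_le_trans q1.
have t0 : 0 < t by rewrite mulr_gt0// subr_gt0.
pose z : R := 2^-1 `^ t.
have z01 : 0 <= z < 1.
  rewrite powR_ge0/=.
  have := @gt0_ltr_powR _ t t0 2^-1 1; rewrite powR1 !nnegrE; apply => //.
  by rewrite invf_lt1// ltr1n.
have C00 : 0 < C0 by rewrite ltr_pwDl ?powR_ge0// powR_gt0// invr_gt0.
have z1 : 0 < 1 - z by rewrite subr_gt0; case/andP: z01.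
exists (C0 * 4 ^+ n / (1 - z)).
  by rewrite divr_gt0// mulr_gt0// exprn_gt0.
move=> l x Q l0 mQ Ql.
pose F k (y : Rn R n) := (C0 * (2^-1 ^+ k * l) `^ e * \1_(shell x l k) y)%:E.
have F0 k y : (0 <= F k y)%E.
  by rewrite lee_fin mulr_ge0// ?mulr_ge0 ?powR_ge0 ?(ltW C00)// indicE ler0n.
have mF k : measurable_fun Q (F k).
  apply/measurable_EFinP; apply: measurable_funM => //.
  by apply: measurable_indic; exact: measurable_shell.
apply: (@le_trans _ _ (\int[mu]_(y in Q) (\sum_(k <oo) F k y))%E).
  apply: ge0_le_integral.
  - exact: mQ.
  - by move=> y _; exact: (riesz_kernel_ge0 (x, y)).
  - exact: (measurable_funTS (measurable_section1 x measurable_riesz_kernel)).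
  - exact: (ge0_emeasurable_sum (fun k y _ _ => F0 k y) (fun k _ => mF k)).
  - by move=> y Qy; exact: (riesz_kernel_le_shells l0 (Ql y Qy)).
rewrite integral_nneseries//.
have -> : C0 * 4 ^+ n / (1 - z) * l `^ t = (C0 * 4 ^+ n * l `^ t) / (1 - z).
  by rewrite mulrAC.
apply: le_trans (nneseries_geometric_le _ z01); last first.
  by rewrite mulr_ge0 ?powR_ge0// mulr_ge0 ?exprn_ge0 ?(ltW C00).
apply: lee_nneseries => [k _ _|k _]; first by apply: integral_ge0 => y _.
have a0 : 0 < 2^-1 ^+ k * l :> R by rewrite mulr_gt0// exprn_gt0// invr_gt0.
have m1 : measurable_fun Q (fun y => (\1_(shell x l k) y)%:E : \bar R).
  by apply/measurable_EFinP; apply: measurable_indic; exact: measurable_shell.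
have c0 : (0 <= (C0 * (2^-1 ^+ k * l) `^ e)%:E)%E.
  by rewrite lee_fin mulr_ge0 ?powR_ge0 ?(ltW C00).
under eq_integral do rewrite /F EFinM.
rewrite (ge0_integralZl mu mQ m1 _ c0); last by move=> y _; rewrite lee_fin.
rewrite (integral_indic mu mQ (measurable_shell x k l0)).
apply: (@le_trans _ _ ((C0 * (2^-1 ^+ k * l) `^ e)%:E *
    ((4 * (2^-1 ^+ k * l)) ^+ n)%:E)%E).
  rewrite lee_wpmul2l ?lee_fin ?mulr_ge0 ?powR_ge0 ?(ltW C00)//.
  apply: le_trans (lebesgue_shell x k l0).
  by apply: le_lebesgue_outer; exact: subIsetl.
rewrite -EFinM lee_fin exprMn -!mulrA ler_wpM2l ?(ltW C00)// mulrCA.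
rewrite ler_wpM2l ?exprn_ge0// -(powR_mulrn _ (ltW a0)) -powRD; last first.
  by rewrite (gt_eqF a0) implybT.
rewrite (_ : e + n%:R = t); last by rewrite /e /t; ring.
have zk : (2^-1 ^+ k) `^ t = z ^+ k :> R.
  by rewrite -(@powR_mulrn R 2^-1 k) ?invr_ge0// powRAC (@powR_mulrn R _ k) ?powR_ge0.
by rewrite powRM ?exprn_ge0 ?invr_ge0 ?(ltW l0)// zk mulrC.
Qed.

End RieszKernel.

(** * A Lipschitz bump of finite norm *)
Section Bump.
Context (R : realType) (n : nat).
Local Notation mu := (lebesgue R n).
Implicit Types x y : 'rV[R]_n.

Definition bump x : R := Num.min 1 (Num.max 0 (2 - `|x|)).

Lemma bump_eq1 x : `|x| <= 1 -> bump x = 1.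
Proof.
move=> x1; rewrite /bump min_l// le_max; apply/orP; right.
by rewrite lerBrDl; lra.
Qed.

Lemma bump_eq0 x : 2 <= `|x| -> bump x = 0.
Proof. by move=> x2; rewrite /bump max_l ?subr_le0// min_r// ler01. Qed.

Lemma bump_lipschitz x y : `|bump x - bump y| <= `|x - y|.
Proof.
have : `| `|x| - `|y| | <= `|x - y| by exact: ler_dist_dist.
rewrite /bump; move: `|x| `|y| `|x - y| => a b c.
rewrite !ler_norml => /andP[h1 h2].
by rewrite /Num.min /Num.max; repeat case: ifPn; rewrite -?leNgt => *; apply/andP; split; lra.
Qed.

Lemma measurable_normr : lebesgue_measurable_fun (fun x => `|x|).
Proof.
apply: (measurability _ (RGenInftyO.measurableE R)) => _ [_ [r ->] <-].
rewrite setTI; have [r0|r0] := leP r 0.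
  rewrite (_ : _ @^-1` _ = set0)//; apply/seteqP; split=> // x /=.
  by rewrite in_itv/= => /lt_le_trans/(_ r0); rewrite normr_lt0.
rewrite (_ : _ @^-1` _ = [set y | `|0 - y| < r]).
  by rewrite ball_box//; exact: measurable_box.
by apply/seteqP; split=> x /=; rewrite in_itv/= sub0r normrN.
Qed.

Lemma measurable_bump : lebesgue_measurable_fun bump.
Proof.
have mB : measurable_fun [set: Rn R n] (fun x : Rn R n => 2 - `|x : 'rV[R]_n|).
  by apply: measurable_funB; [exact: measurable_cst|exact: measurable_normr].
have mM : measurable_fun [set: Rn R n]
    (fun x : Rn R n => Num.max 0 (2 - `|x : 'rV[R]_n|)).
  by apply: measurable_maxr; [exact: measurable_cst|exact: mB].
apply: (@measurable_minr _ (Rn R n) R setT (fun=> 1) _ _ mM).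
exact: measurable_cst.
Qed.

Lemma cube_diam (l : R) (Q : set 'rV[R]_n) x y : 0 <= l -> is_cube l Q ->
  Q x -> Q y -> `|x - y| <= l.
Proof.
move=> l0 /cube_between[a [_ Qb]] /Qb xb /Qb yb.
apply: mx_norm_le => // i; have := xb i; have := yb i.
by rewrite !mxE ler_norml => /andP[? ?] /andP[? ?]; apply/andP; split; lra.
Qed.

Context (alpha q : R).
Hypotheses (q1 : 1 <= q) (alpha1 : alpha < 1).

Definition bump_supp : set (Rn R n) := [set x : 'rV[R]_n | `|x| < 2].

Lemma measurable_bump_supp : measurable bump_supp.
Proof.
rewrite /bump_supp (_ : [set _ | _] = [set y : 'rV[R]_n | `|0 - y| < 2]).
  by rewrite ball_box//; exact: measurable_box.
by apply/seteqP; split=> x /=; rewrite sub0r normrN.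
Qed.

Lemma lebesgue_bump_supp : (mu bump_supp <= (4 ^+ n)%:E)%E.
Proof.
rewrite /bump_supp (_ : [set _ | _] = [set y : 'rV[R]_n | `|0 - y| < 2]).
  rewrite ball_box//; apply: le_trans (lebesgue_outer_box _) _.
  rewrite lee_fin /box_vol.
  under eq_bigr => i _.
    rewrite /= !mxE (_ : _ - _ = 4); last by ring.
    rewrite max_r//.
    over.
  by rewrite prodr_const card_ord.
by apply/seteqP; split=> x /=; rewrite sub0r normrN.
Qed.

(** The bump is 1-Lipschitz, and its difference vanishes when both points lie
    off the support. *)
Lemma diff_quotient_bump_le (x y : Rn R n) :
  (diff_quotient alpha q bump (x, y) <=
   (\1_bump_supp x)%:E * riesz_kernel alpha q (x, y) +
   (\1_bump_supp y)%:E * riesz_kernel alpha q (x, y))%E.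
Proof.
have q0 : 0 < q by exact: lt_le_trans q1.
have bk : (diff_quotient alpha q bump (x, y) <= riesz_kernel alpha q (x, y))%E.
  rewrite lee_fin /= ler_wpM2r ?invr_ge0 ?powR_ge0//.
  apply: ge0_ler_powR; rewrite ?nnegrE ?sqrtr_ge0 ?(ltW q0)//.
  by apply: le_trans (bump_lipschitz _ _) _; exact: normr_le_enorm.
have k0 := riesz_kernel_ge0 alpha q (x, y).
have i0 z : (0 <= (\1_bump_supp z)%:E * riesz_kernel alpha q (x, y))%E.
  by rewrite mule_ge0// lee_fin indicE ler0n.
have [xS|xS] := boolP (x \in bump_supp).
  apply: le_trans bk _; rewrite -[leLHS]adde0; apply: leeD (i0 y).
  by rewrite indicE xS mul1e.
have [yS|yS] := boolP (y \in bump_supp).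
  apply: le_trans bk _; rewrite -[leLHS]add0e; apply: leeD (i0 x) _.
  by rewrite indicE yS mul1e.
rewrite !indicE (negbTE xS) (negbTE yS) !mul0e adde0 lee_fin /=.
rewrite !bump_eq0.
- by rewrite subrr normr0 powR0 ?gt_eqF// mul0r.
- by move: yS; rewrite notin_setE /bump_supp /= => /negP; rewrite -leNgt.
- by move: xS; rewrite notin_setE /bump_supp /= => /negP; rewrite -leNgt.
Qed.

(** The two terms of [diff_quotient_bump_le] have the same integral, since the
    kernel is symmetric, and in the first one only the x of the support count. *)
Lemma bump_double_integral_le : exists2 C : R, 0 < C &
  forall (l : R) (Q : set (Rn R n)), 0 < l -> is_cube l Q ->
  (\int[mu]_(x in Q) \int[mu]_(y in Q) diff_quotient alpha q bump (x, y) <=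
   (C * l `^ (q * (1 - alpha)))%:E * mu (bump_supp `&` Q))%E.
Proof.
have [C C0 kC] := @riesz_kernel_integral_le R n alpha q q1 alpha1.
exists (2 * C); first by rewrite mulr_gt0.
move=> l Q l0 cQ; have mQ := measurable_cube cQ.
set t := q * (1 - alpha).
have mi : measurable_fun [set: Rn R n] (\1_bump_supp : Rn R n -> R).
  by apply: measurable_indic; exact: measurable_bump_supp.
have mS : measurable_fun setT (fun z : Rn R n * Rn R n => (\1_bump_supp z.1)%:E : \bar R).
  apply/measurable_EFinP.
  exact: (measurableT_comp mi measurable_fst).
have mS' : measurable_fun setT (fun z : Rn R n * Rn R n => (\1_bump_supp z.2)%:E : \bar R).
  apply/measurable_EFinP.
  exact: (measurableT_comp mi measurable_snd).
have k0 := @riesz_kernel_ge0 R n alpha q.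
have mk := @measurable_riesz_kernel R n alpha q.
pose G1 (z : Rn R n * Rn R n) := ((\1_bump_supp z.1)%:E * riesz_kernel alpha q z)%E.
pose G2 (z : Rn R n * Rn R n) := ((\1_bump_supp z.2)%:E * riesz_kernel alpha q z)%E.
have G10 z : (0 <= G1 z)%E by rewrite /G1 mule_ge0// lee_fin indicE ler0n.
have G20 z : (0 <= G2 z)%E by rewrite /G2 mule_ge0// lee_fin indicE ler0n.
have mG1 : measurable_fun setT G1 by exact: emeasurable_funM.
have mG2 : measurable_fun setT G2 by exact: emeasurable_funM.
have G12_0 z : (0 <= G1 z + G2 z)%E by exact: adde_ge0.
have mG12 : measurable_fun setT (fun z => G1 z + G2 z)%E by exact: emeasurable_funD.
apply: le_trans (@le_double_integral _ _ _ mu (diff_quotient alpha q bump)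
  (fun z => G1 z + G2 z)%E Q mQ (measurable_diff_quotient _ _ measurable_bump)
  (diff_quotient_ge0 _ _ _) mG12 G12_0 (fun x y _ _ => diff_quotient_bump_le x y)) _.
rewrite (double_integralD mu mQ mG1 G10 mG2 G20).
have G2E x y : G2 (x, y) = G1 (y, x) by rewrite /G1 /G2 /= riesz_kernelC.
have -> : (\int[mu]_(x in Q) \int[mu]_(y in Q) G2 (x, y) =
           \int[mu]_(x in Q) \int[mu]_(y in Q) G1 (x, y))%E.
  rewrite (double_integral_swap mu mQ mG1 G10).
  by apply: eq_integral => x _; apply: eq_integral => y _; exact: G2E.
suff I1 : (\int[mu]_(x in Q) \int[mu]_(y in Q) G1 (x, y) <=
    (C * l `^ t)%:E * mu (bump_supp `&` Q))%E.
  rewrite -mulrA [(2 * _)%:E]EFinM -muleA mule_natl mule2n.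
  exact: leeD.
have c0 : (0 <= (C * l `^ t)%:E)%E by rewrite lee_fin mulr_ge0 ?powR_ge0// ltW.
have mS1 : measurable_fun Q (fun x => (\1_bump_supp x)%:E : \bar R).
  by apply/measurable_EFinP; apply: measurable_indic; exact: measurable_bump_supp.
rewrite -(integral_indic mu mQ measurable_bump_supp) -(ge0_integralZl mu mQ mS1 _ c0); last first.
  by move=> x _; rewrite lee_fin.
apply: ge0_le_integral.
- exact: mQ.
- by move=> x _; apply: integral_ge0 => y _; exact: (G10 (x, y)).
- exact: (measurable_funTS (measurable_inner_integral mu mQ mG1 G10)).
- exact: measurable_funeM.
move=> x Qx.
have S0 : (0 <= (\1_bump_supp x)%:E :> \bar R)%E by rewrite lee_fin indicE ler0n.
rewrite [leLHS](ge0_integralZl mu mQ (measurable_funTS (measurable_section1 x mk))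
  (fun y _ => k0 (x, y)) S0).
rewrite muleC lee_wpmul2r// kC// => y Qy; exact: cube_diam (ltW l0) cQ Qx Qy.
Qed.

End Bump.

(** The arithmetic of exponents behind [JNQ_bump], with r = p / q: for l <= 1 the
    bound m <= l ^ n leaves l ^ (q r) <= 1, and for l >= 1 the bound m <= B leaves
    a nonpositive power of l. *)
Lemma powR_scale_le (R : realType) (n : nat) (q r A B l m : R) :
  0 <= q -> 1 <= r -> n%:R + (q - n%:R) * r <= 0 ->
  0 <= A -> 1 <= B -> 0 < l -> 0 <= m -> m <= l ^+ n -> m <= B ->
  l ^+ n * (A * l `^ (q - n%:R) * m) `^ r <= A `^ r * B `^ (r - 1) * m.
Proof.
move=> q0 r1 nr A0 B1 l0 m0 ml mB.
have r0 : 0 < r by exact: lt_le_trans r1.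
have r10 : 0 <= r - 1 by rewrite subr_ge0.
have B0 : 0 <= B by exact: le_trans B1.
have lq0 := powR_ge0 l (q - n%:R).
rewrite powRM ?mulr_ge0// powRM// -(mulr_powRB1 m0 r0).
rewrite (_ : _ * _ = A `^ r * (l ^+ n * (l `^ (q - n%:R)) `^ r * m `^ (r - 1)) * m); last by ring.
rewrite ler_wpM2r// ler_wpM2l ?powR_ge0// -powRrM -(powR_mulrn _ (ltW l0)).
rewrite -powRD; last by rewrite (gt_eqF l0) implybT.
have [l1|l1] := leP l 1.
  apply: (@le_trans _ _ (l `^ (n%:R + (q - n%:R) * r) * l `^ (n%:R * (r - 1)))).
    rewrite ler_wpM2l ?powR_ge0// powRrM powR_mulrn ?(ltW l0)//.
    by apply: ge0_ler_powR; rewrite ?nnegrE ?(exprn_ge0 n (ltW l0)). 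
  rewrite -powRD; last by rewrite (gt_eqF l0) implybT.
  rewrite (_ : _ + _ = q * r); last by ring.
  apply: (@le_trans _ _ 1).
    rewrite -[leRHS](powRr0 l); apply: ger_powR; first by rewrite l0.
    by rewrite mulr_ge0// ltW.
  by rewrite -[leLHS](powRr0 B); apply: ler_powR.
rewrite -[leRHS]mul1r ler_pM ?powR_ge0//.
  by rewrite -[leRHS](powRr0 l); apply: ler_powR; rewrite // ltW.
by apply: ge0_ler_powR; rewrite ?nnegrE.
Qed.

Lemma esum_measure_trivIset_le d (T : measurableType d) (R : realType)
    (m : {measure set T -> \bar R}) (I : choiceType) (P : set I)
    (F : I -> set T) (S : set T) :
  measurable S -> (forall i, P i -> measurable (F i)) -> trivIset P F ->
  (\esum_(i in P) m (S `&` F i) <= m S)%E.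
Proof.
move=> mS mF tF; apply: ge_ereal_sup => _ [X [finX XP] <-].
have mSF i : X i -> measurable (S `&` F i) by move=> /XP/mF; exact: measurableI.
rewrite -(measure_fin_bigcup m finX _ mSF); last first.
  apply: (sub_trivIset XP) => i j Pi Pj [x [[_ Fix] [_ Fjx]]].
  by apply: tF => //; exists x.
apply: le_measure; rewrite ?inE//; first exact: fin_bigcup_measurable.
by move=> x [i _ []].
Qed.

Section BumpJNQ.
Context (R : realType) (n : nat).
Local Notation mu := (lebesgue R n).

Lemma box_sub_interior (c : 'rV[R]_n * 'rV[R]_n) (Q : set 'rV[R]_n) :
  box c `<=` Q -> box c `<=` Q°.
Proof.
move=> cQ x cx; rewrite /interior/=.
apply: (@filterS _ (nbhs x) _ (box c)) => //.
pose f (i : 'I_n) := [set y : 'rV[R]_n | c.1 ord0 i < y ord0 i < c.2 ord0 i].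
apply: (@filter_forall _ _ f (nbhs x)) => i.
have xi : x ord0 i \in `]c.1 ord0 i, c.2 ord0 i[ by rewrite in_itv/=; exact: cx.
have xf := @coord_continuous R 1 n ord0 i x _ (near_in_itvoo xi).
by apply: (@filterS _ (nbhs x) _ _ _ _ xf) => y; rewrite /f /= in_itv.
Qed.

(** Only the interiors of the cubes of a collection are disjoint, so each cube is
    replaced by an open box inside its interior; the difference is null. *)
Lemma cube_open_core (l : R) (Q : set (Rn R n)) : is_cube l Q ->
  exists B : set (Rn R n), [/\ measurable B, B `<=` (Q : set 'rV[R]_n)° &
    forall S, (mu (S `&` Q) <= mu (S `&` B))%E].
Proof.
move=> /cube_between[a [aQ Qa]].
pose b := box (a, a + const_mx l); pose c := cbox a (a + const_mx l).
exists b; split; [exact: measurable_box|exact: box_sub_interior|move=> S].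
have SQ : S `&` Q `<=` (S `&` b) `|` (c `\` b).
  by move=> x [Sx Qx]; have [xb|xb] := pselect (b x); [left|right; split=> //; exact: Qa].
apply: le_trans (le_lebesgue_outer SQ) _.
apply: le_trans (lebesgue_outer_subadditive _ _) _.
by rewrite lebesgue_outer_cboxD adde0.
Qed.

Context (alpha p q : R).
Hypotheses (n1 : (1 <= n)%N) (alpha1 : alpha < 1) (q1 : 1 <= q) (qp : q <= p).
Hypothesis npq : n%:R + (q - n%:R) * (p / q) <= 0.

Lemma JNQ_bump : JNQ alpha p q (@bump R n).
Proof.
split; first exact: measurable_bump.
have q0 : 0 < q by exact: lt_le_trans q1.
have p1 : 1 <= p by exact: le_trans qp.
have r1 : 1 <= p / q by rewrite ler_pdivlMr// mul1r.
have r0 : 0 <= p / q by exact: le_trans r1.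
have [C C0 IC] := @bump_double_integral_le R n alpha q q1 alpha1.
pose S := @bump_supp R n.
have mS : measurable S := @measurable_bump_supp R n.
have S4 : (mu S <= (4 ^+ n)%:E)%E := @lebesgue_bump_supp R n.
pose D := C `^ (p / q) * (4 ^+ n) `^ (p / q - 1).
have D0 : 0 <= D by rewrite mulr_ge0 ?powR_ge0.
apply/JNQ_norm_ltyP => //; exists (D * 4 ^+ n) => l P l0 [cP tP].
pose core (Q B : set (Rn R n)) := P Q -> [/\ measurable B,
  B `<=` (Q : set 'rV[R]_n)° & forall S, (mu (S `&` Q) <= mu (S `&` B))%E].
have [B BP] : {B : set (Rn R n) -> set (Rn R n) & forall Q, core Q (B Q)}.
  apply: (@choice _ _ core) => Q.
  have [/cP/cube_open_core[B ?]|nPQ] := pselect (P Q); first by exists B.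
  by exists set0.
apply: (@le_trans _ _ (\esum_(Q in P) (D%:E * mu (S `&` B Q)))%E); last first.
  apply: le_trans (esum_mul_le _ D0 _) _ => //.
  rewrite [leRHS]EFinM lee_wpmul2l ?lee_fin//; apply: le_trans S4.
  apply: esum_measure_trivIset_le => //.
    by move=> Q /BP[].
  move=> Q1 Q2 P1 P2 [x [x1 x2]]; apply: tP => //.
  by exists x; split; [have [_ + _] := BP _ P1|have [_ + _] := BP _ P2]; apply.
apply: le_esum => Q PQ; have cQ := cP _ PQ; have mQ := measurable_cube cQ.
have [_ _ SB] := BP _ PQ.
apply: (@le_trans _ _ (D%:E * mu (S `&` Q))%E); last by rewrite lee_wpmul2l ?lee_fin.
have muQ : mu Q = (l ^+ n)%:E := lebesgue_cube (ltW l0) cQ.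
have SQl : (mu (S `&` Q) <= (l ^+ n)%:E)%E.
  by rewrite -muQ; apply: le_lebesgue_outer; exact: subIsetr.
have SQ4 : (mu (S `&` Q) <= (4 ^+ n)%:E)%E.
  by apply: le_trans S4; apply: le_lebesgue_outer; exact: subIsetl.
have SQfin : mu (S `&` Q) \is a fin_num.
  by rewrite ge0_fin_numE//; apply: le_lt_trans SQl _; exact: ltry.
have SQ0 : (0 <= mu (S `&` Q))%E by [].
have osc_le : (oscillation alpha q (@bump R n) Q <=
    (C * l `^ (q - n%:R) * fine (mu (S `&` Q)))%:E)%E.
  rewrite oscillationE muQ poweR_EFin.
  apply: (@le_trans _ _ (((l ^+ n) `^ (q * alpha / n%:R - 1))%:E *
      ((C * l `^ (q * (1 - alpha)))%:E * mu (S `&` Q)))%E).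
    by rewrite lee_wpmul2l ?lee_fin ?powR_ge0//; exact: IC.
  rewrite -[in leLHS](fineK SQfin) -!EFinM lee_fin mulrA ler_wpM2r ?fine_ge0//.
  rewrite mulrCA ler_wpM2l ?(ltW C0)// -(powR_mulrn _ (ltW l0)) -powRrM.
  rewrite -powRD; last by rewrite (gt_eqF l0) implybT.
  rewrite (_ : _ + _ = q - n%:R)//.
  by field; rewrite pnatr_eq0 -lt0n.
rewrite muQ; apply: (@le_trans _ _ ((l ^+ n)%:E *
    (C * l `^ (q - n%:R) * fine (mu (S `&` Q)))%:E `^ (p / q))%E).
  rewrite lee_wpmul2l ?lee_fin ?(exprn_ge0 n (ltW l0))//.
  apply: gt0_ler_poweR; rewrite ?in_itv/= ?leey ?andbT ?oscillation_ge0//.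
  by apply: le_trans osc_le; exact: oscillation_ge0.
rewrite poweR_EFin -(fineK SQfin) -!EFinM lee_fin /=.
apply: powR_scale_le; rewrite ?fine_ge0 ?(ltW q0) ?(ltW C0)//.
- by rewrite exprn_ege1// ler1n.
- by rewrite -lee_fin fineK.
- by rewrite -lee_fin fineK.
Qed.

End BumpJNQ.

(** * Composition with continuous and Lipschitz functions *)
Section Composition.
Context (R : realType) (n : nat).
Local Notation mu := (lebesgue R n).

Lemma measurable_left_composition (L : R -> R) (f : 'rV[R]_n -> R) :
  continuous L -> lebesgue_measurable_fun f ->
  lebesgue_measurable_fun (left_composition L f).
Proof.
by move=> cL mf; apply: (measurableT_comp _ mf); exact: continuous_measurable_fun.
Qed.

(** Lebesgue measure is complete, being the restriction of its outer measure to
    the Caratheodory sets. *)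
Lemma ae_eq_lebesgue_measurable (f g : 'rV[R]_n -> R) :
  lebesgue_measurable_fun g -> {ae mu, forall x, f x = g x} ->
  lebesgue_measurable_fun f.
Proof.
move=> mg fg; apply/measurable_EFinP.
apply: (@ae_measurable_fun _ _ _ mu (@measure_is_complete_caratheodory _ _ _)
  setT (EFin \o g)); last by apply/measurable_EFinP.
have aeF : Filter (almost_everywhere mu).
  exact: (@ae_filter_ringOfSetsType _ _ _ mu).
by apply: (@filterS _ _ aeF _ _ _ fg) => x fgx _ /=; rewrite fgx.
Qed.

End Composition.

Lemma LipP (R : realType) (L : R -> R) : continuous L ->
  Lip R L <-> exists2 K : R, 0 < K & forall x y, `|L x - L y| <= K * `|x - y|.
Proof.
move=> cL; split=> [[_ supL]|[K K0 LK]]; last split.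
- set s := ereal_sup _ in supL.
  exists (`|fine s| + 1); first by rewrite ltr_wpDl.
  move=> x y; have [->|xy] := eqVneq x y; first by rewrite !subrr normr0 mulr0.
  have xy0 : 0 < `|x - y| by rewrite normr_gt0 subr_eq0.
  have qs : ((`|L x - L y| / `|x - y|)%:E <= s)%E.
    by apply: ereal_sup_ubound; exists x, y.
  have sfin : s \is a fin_num.
    by rewrite ge0_fin_numE// (le_trans _ qs)// lee_fin divr_ge0.
  rewrite -ler_pdivrMr//; move: qs; rewrite -(fineK sfin) lee_fin => /le_trans; apply.
  by rewrite (le_trans (ler_norm _))// lerDl.
- move=> _ Y mY; rewrite setTI; apply: sub_caratheodory.
  rewrite -[X in measurable X]setTI.
  exact: (continuous_measurable_fun cL).
- apply: (@le_lt_trans _ _ K%:E); last exact: ltry.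
  apply: ge_ereal_sup => _ [x [y [xy ->]]].
  by rewrite lee_fin ler_pdivrMr// normr_gt0 subr_eq0.
Qed.

Section LowerBound.
Context (R : realType) (n : nat) (alpha p q : R).
Hypotheses (n1 : (1 <= n)%N) (q1 : 1 <= q) (p1 : 1 <= p).
Local Notation mu := (lebesgue R n).

Let unit_box (r : R) : set (Rn R n) :=
  box (const_mx r : 'rV[R]_n, const_mx r + const_mx 1).

Let unit_boxP r (x : 'rV[R]_n) : unit_box r x <-> forall i, r < x ord0 i < r + 1.
Proof. by split=> xr i; have := xr i; rewrite /= !mxE. Qed.

Let lebesgue_unit_box r : mu (unit_box r) = 1%:E.
Proof.
rewrite -(expr1n R n).
apply: (@lebesgue_outer_between R n (const_mx r) 1) => // x xr i.
by have /andP[/ltW-> /ltW->] := xr i.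
Qed.

(** One cube suffices: it contains the unit boxes E and F, on which h equals u
    and v, and the Euclidean distance from E to F stays between 2 and
    4 sqrt n. *)
Lemma JNQ_norm_jump_ge : exists2 c : R, 0 < c &
  forall (h : 'rV[R]_n -> R) (u v : R), lebesgue_measurable_fun h ->
  (forall x, `|x| <= 1 -> h x = u) -> (forall x, 2 <= `|x| -> h x = v) ->
  ((c * `|u - v|)%:E <= JNQ_norm alpha p q h)%E.
Proof.
have q0 : 0 < q by exact: lt_le_trans q1.
have p0 : 0 < p by exact: lt_le_trans p1.
have pq0 : 0 <= p / q by rewrite divr_ge0 ?ltW.
pose Q : set (Rn R n) := box (const_mx (-4) : 'rV[R]_n, const_mx (-4) + const_mx 8).
have cQ : is_cube 8 Q.
  exists (const_mx (-4)), (fun=> false), (fun=> true).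
  by apply/seteqP; split=> x xQ i; have := xQ i; rewrite /= in_itv/= !mxE.
have mQ := measurable_cube cQ.
have muQ : mu Q = (8 ^+ n)%:E by exact: lebesgue_cube cQ.
pose E := unit_box 0; pose F := unit_box 3.
have mE : measurable E by exact: measurable_box.
have mF : measurable F by exact: measurable_box.
have muE : mu E = 1%:E by exact: lebesgue_unit_box.
have muF : mu F = 1%:E by exact: lebesgue_unit_box.
have EQ : E `&` Q = E.
  apply: setIidl => x /unit_boxP xE i; have := xE i; rewrite /= !mxE => /andP[? ?].
  by apply/andP; split; lra.
have FQ : F `&` Q = F.
  apply: setIidl => x /unit_boxP xF i; have := xF i; rewrite /= !mxE => /andP[? ?].
  by apply/andP; split; lra.
pose s := n%:R + q * alpha.
pose M : R := 2 `^ s + (Num.sqrt n%:R * 4) `^ s.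
have M0 : 0 < M by rewrite ltr_pwDl ?powR_ge0// powR_gt0.
have EF x y : E x -> F y -> enorm ((x : 'rV[R]_n) - y) `^ s <= M.
  move=> /unit_boxP xE /unit_boxP yF; apply: powR_between => //.
    apply: le_trans (normr_le_enorm _).
    apply: le_trans (normr_coord_le _ (Ordinal n1)); rewrite !mxE.
    have := xE (Ordinal n1); have := yF (Ordinal n1) => /andP[? ?] /andP[? ?].
    by rewrite ler0_norm; lra.
  apply: le_trans (enorm_le_normr _) _; rewrite ler_wpM2l ?sqrtr_ge0//.
  apply: mx_norm_le => // i; rewrite !mxE.
  have := xE i; have := yF i => /andP[? ?] /andP[? ?].
  by rewrite ler_norml; apply/andP; split; lra.
pose A := (8 ^+ n) `^ (q * alpha / n%:R - 1) / M.
have A0 : 0 < A by rewrite divr_gt0// powR_gt0// exprn_gt0.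
exists ((8 ^+ n) `^ p^-1 * A `^ q^-1).
  by rewrite mulr_gt0// powR_gt0// exprn_gt0.
move=> h u v mh hu hv.
pose w := `|u - v| `^ q / M.
have w0 : 0 <= w by rewrite divr_ge0 ?powR_ge0 ?(ltW M0).
have mi (B : set (Rn R n)) : measurable B ->
    measurable_fun [set: Rn R n] (\1_B : Rn R n -> R).
  by move=> mB; apply: measurable_indic; exact: mB.
have ie (B : set (Rn R n)) : measurable B ->
    measurable_fun Q (fun x => (\1_B x)%:E : \bar R).
  by move=> mB; apply/measurable_EFinP; apply: measurable_indic; exact: mB.
pose G (z : Rn R n * Rn R n) := (w * \1_E z.1 * \1_F z.2)%:E.
have G0 z : (0 <= G z)%E by rewrite lee_fin mulr_ge0// mulr_ge0.
have mG : measurable_fun setT G.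
  apply/measurable_EFinP; apply: measurable_funM.
    apply: measurable_funM; first exact: measurable_cst.
    exact: (measurableT_comp (mi _ mE) measurable_fst).
  exact: (measurableT_comp (mi _ mF) measurable_snd).
(* G is constant on E x F and vanishes elsewhere. *)
have GD x y : (G (x, y) <= diff_quotient alpha q h (x, y))%E.
  rewrite /G lee_fin /= !indicE.
  have [xE|_] := boolP (x \in E); last first.
    by rewrite mulr0 mul0r divr_ge0 ?powR_ge0.
  have [yF|_] := boolP (y \in F); last first.
    by rewrite mulr0 divr_ge0 ?powR_ge0.
  move: xE yF; rewrite !inE !mulr1 => xE yF.
  rewrite hu ?hv.
  - rewrite /w ler_wpM2l ?powR_ge0// lef_pV2 ?posrE//; first exact: EF.
    rewrite powR_gt0//; apply: lt_le_trans (normr_le_enorm _).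
    rewrite normr_gt0 subr_eq0; apply/eqP => xy.
    move/unit_boxP : xE => /(_ (Ordinal n1)); move/unit_boxP : yF => /(_ (Ordinal n1)).
    by rewrite xy => /andP[? ?] /andP[? ?]; lra.
  - apply: le_trans (normr_coord_le _ (Ordinal n1)).
    move/unit_boxP : yF => /(_ (Ordinal n1)) /andP[y3 _].
    by rewrite ger0_norm; lra.
  - apply: mx_norm_le => // i; move/unit_boxP : xE => /(_ i) /andP[? ?].
    by rewrite ler_norml; apply/andP; split; lra.
have iE : (\int[mu]_(x in Q) (\1_E x)%:E = 1%:E)%E.
  by rewrite (integral_indic mu mQ mE) EQ; exact: muE.
have iF : (\int[mu]_(x in Q) (\1_F x)%:E = 1%:E)%E.
  by rewrite (integral_indic mu mQ mF) FQ; exact: muF.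
have IG : (\int[mu]_(x in Q) \int[mu]_(y in Q) G (x, y) = w%:E)%E.
  have inner x : (\int[mu]_(y in Q) G (x, y) = w%:E * (\1_E x)%:E)%E.
    under eq_integral do rewrite /G /= EFinM.
    have wE : (0 <= (w * \1_E x)%:E)%E by rewrite lee_fin mulr_ge0.
    rewrite (ge0_integralZl mu mQ (ie _ mF) _ wE); last by move=> y _; rewrite lee_fin.
    by rewrite iF mule1 EFinM.
  under eq_integral do rewrite inner.
  have wE : (0 <= w%:E)%E by rewrite lee_fin.
  rewrite (ge0_integralZl mu mQ (ie _ mE) _ wE); last by move=> y _; rewrite lee_fin.
  by rewrite iE mule1.
have osc_ge : ((A * `|u - v| `^ q)%:E <= oscillation alpha q h Q)%E.
  rewrite oscillationE muQ poweR_EFin.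
  have -> : A * `|u - v| `^ q = (8 ^+ n) `^ (q * alpha / n%:R - 1) * w.
    by rewrite /A /w mulrAC mulrA.
  rewrite [leLHS]EFinM lee_wpmul2l ?lee_fin ?powR_ge0// -IG.
  exact: (@le_double_integral _ _ _ mu G (diff_quotient alpha q h) Q mQ mG G0
    (measurable_diff_quotient _ _ mh) (diff_quotient_ge0 _ _ _)
    (fun x y _ _ => GD x y)).
clearbody A.
apply: (@le_trans _ _ ((mu Q * oscillation alpha q h Q `^ (p / q)) `^ p^-1)%E); last first.
  apply: ereal_sup_ubound; exists 8, [set Q]; split => //.
    by split=> [_ ->//|_ _ -> ->].
  rewrite esum_set1// mule_ge0 ?poweR_ge0//; exact: lebesgue_outer_ge0.
apply: (@le_trans _ _ (((8 ^+ n)%:E * (A * `|u - v| `^ q)%:E `^ (p / q)) `^ p^-1)%E).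
  rewrite (poweR_EFin (A * _)) -EFinM poweR_EFin lee_fin.
  rewrite [leRHS]powRM ?powR_ge0 ?exprn_ge0// -mulrA ler_wpM2l ?powR_ge0// -powRrM.
  have -> : p / q * p^-1 = q^-1 by rewrite mulrAC divff ?gt_eqF// mul1r.
  rewrite [leRHS]powRM ?powR_ge0 ?(ltW A0)// ler_wpM2l ?powR_ge0//.
  by rewrite -powRrM divff ?gt_eqF// powRr1.
apply: gt0_ler_poweR; rewrite ?in_itv/= ?leey ?andbT ?invr_ge0 ?(ltW p0)//.
- by rewrite -EFinM lee_fin mulr_ge0 ?powR_ge0 ?exprn_ge0.
- by rewrite mule_ge0 ?poweR_ge0.
rewrite muQ -poweR_EFin lee_wpmul2l ?lee_fin ?exprn_ge0//.
apply: gt0_ler_poweR; rewrite ?in_itv/= ?leey ?andbT ?oscillation_ge0//.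
by rewrite lee_fin mulr_ge0 ?powR_ge0 ?(ltW A0).
Qed.

End LowerBound.

(** * The Lipschitz solutions of t = u - 1/u *)
Section RootPair.
Context (R : realType).

(** The roots of X ^ 2 - t X - 1 are [upper_root t] and the opposite of
    [lower_root t]; their product is -1. *)
Definition upper_root (t : R) : R := (t + Num.sqrt (t ^+ 2 + 4)) / 2.
Definition lower_root (t : R) : R := (Num.sqrt (t ^+ 2 + 4) - t) / 2.

(** With S and T the two roots, (S - T) (S + T) = (s - t) (s + t) and
    |s + t| <= S + T. *)
Lemma sqrt_sqrD4_lipschitz (s t : R) :
  `|Num.sqrt (s ^+ 2 + 4) - Num.sqrt (t ^+ 2 + 4)| <= `|s - t|.
Proof.
have sq4 (x : R) : 0 <= x ^+ 2 + 4 by rewrite addr_ge0// sqr_ge0.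
have gt (x : R) : `|x| < Num.sqrt (x ^+ 2 + 4).
  by rewrite -sqrtr_sqr ltr_sqrt ?ltrDl// ltr_wpDl// sqr_ge0.
set S := Num.sqrt (s ^+ 2 + 4); set T := Num.sqrt (t ^+ 2 + 4).
have ST0 : 0 < S + T.
  by rewrite addr_gt0//; [exact: le_lt_trans (gt s)|exact: le_lt_trans (gt t)].
rewrite -(ler_pM2r ST0) -{1}(ger0_norm (ltW ST0)) -normrM.
have -> : (S - T) * (S + T) = (s - t) * (s + t).
  transitivity (S ^+ 2 - T ^+ 2); first by ring.
  by rewrite !sqr_sqrtr//; ring.
rewrite normrM ler_wpM2l//; apply: le_trans (ler_normD _ _) _.
by rewrite lerD// ltW// gt.
Qed.

Lemma upper_root_lipschitz (s t : R) : `|upper_root s - upper_root t| <= `|s - t|.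
Proof.
have := sqrt_sqrD4_lipschitz s t; rewrite /upper_root.
move: (Num.sqrt (s ^+ 2 + 4)) (Num.sqrt (t ^+ 2 + 4)) => S T ST.
rewrite (_ : _ - _ = ((s - t) + (S - T)) / 2); last by ring.
rewrite normrM (ger0_norm (_ : 0 <= 2^-1)) ?invr_ge0//.
rewrite ler_pdivrMr// mulrDr mulr1 (le_trans (ler_normD _ _))//.
by rewrite lerD.
Qed.

Lemma lower_root_lipschitz (s t : R) : `|lower_root s - lower_root t| <= `|s - t|.
Proof.
have := sqrt_sqrD4_lipschitz s t; rewrite /lower_root.
move: (Num.sqrt (s ^+ 2 + 4)) (Num.sqrt (t ^+ 2 + 4)) => S T ST.
rewrite (_ : _ - _ = ((t - s) + (S - T)) / 2); last by ring.
rewrite normrM (ger0_norm (_ : 0 <= 2^-1)) ?invr_ge0//.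
rewrite ler_pdivrMr// mulrDr mulr1 (le_trans (ler_normD _ _))//.
by rewrite lerD// distrC.
Qed.

Lemma upper_rootM t : upper_root t * lower_root t = 1.
Proof.
rewrite /upper_root /lower_root.
have := @sqr_sqrtr R (t ^+ 2 + 4); rewrite addr_ge0 ?sqr_ge0// => /(_ isT).
by move: (Num.sqrt _) => S S2; field: S2.
Qed.

Lemma upper_rootV t : (upper_root t)^-1 = lower_root t.
Proof.
have u0 : upper_root t != 0.
  by apply/eqP => u0; have := upper_rootM t; rewrite u0 mul0r => /esym/eqP; rewrite oner_eq0.
by rewrite -[RHS](mulKf u0) upper_rootM mulr1.
Qed.

Lemma upper_root_neq0 t : upper_root t != 0.
Proof.
by apply/eqP => u0; have := upper_rootM t; rewrite u0 mul0r => /esym/eqP; rewrite oner_eq0.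
Qed.

Lemma upper_rootB t : upper_root t - lower_root t = t.
Proof. by rewrite /upper_root /lower_root; field. Qed.

Lemma lipschitz_continuous (h : R -> R) (K : R) : 0 < K ->
  (forall x y, `|h x - h y| <= K * `|x - y|) -> continuous h.
Proof.
move=> K0 hK x; apply/cvgrPdist_lt => e e0; near=> y.
apply: le_lt_trans (hK x y) _.
rewrite mulrC -ltr_pdivlMr//; near: y.
by apply: cvgr_dist_lt => //; rewrite divr_gt0.
Unshelve. all: by end_near.
Qed.

End RootPair.

(** * Bounded composition operators *)
Section Main.
Context (R : realType) (n : nat) (alpha p q : R).
Hypotheses (n1 : (1 <= n)%N) (alpha1 : alpha < 1) (p1 : 1 <= p) (q1 : 1 <= q).

Lemma JNQ_left_composition (L : R -> R) (K : R) (f : 'rV[R]_n -> R) : 0 < K ->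
  (forall x y, `|L x - L y| <= K * `|x - y|) -> JNQ alpha p q f ->
  JNQ alpha p q (left_composition L f).
Proof.
move=> K0 LK [mf flty]; have cL := lipschitz_continuous K0 LK.
have mLf := measurable_left_composition cL mf; split; first exact: mLf.
apply: le_lt_trans (JNQ_norm_lipschitz _ q1 p1 mf mLf K0 (fun x y => LK _ _)) _.
by apply: lte_mul_pinfty => //; rewrite lee_fin ltW.
Qed.

(** Tested on the functions b + (a - b) phi, with phi the bump. *)
Lemma lipschitz_of_bounded (L : R -> R) : JNQ alpha p q (@bump R n) ->
  continuous L -> bounded_on_JNQ alpha p q (@left_composition R n L) ->
  exists2 K : R, 0 < K & forall x y, `|L x - L y| <= K * `|x - y|.
Proof.
move=> [mb blty] cL [C C0 LC].
have [c c0 jump] := @JNQ_norm_jump_ge R n alpha p q n1 q1 p1.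
pose B := fine (JNQ_norm alpha p q (@bump R n)).
have b0 : (0 <= JNQ_norm alpha p q (@bump R n))%E.
  apply: le_trans (jump _ 1 0 mb (@bump_eq1 R n) (@bump_eq0 R n)).
  by rewrite lee_fin mulr_ge0// ltW.
have bE : JNQ_norm alpha p q (@bump R n) = B%:E.
  by rewrite /B fineK// ge0_fin_numE.
have B0 : 0 <= B by rewrite -lee_fin -bE.
exists (C * B / c + 1); first by rewrite ltr_wpDl// (divr_ge0 (mulr_ge0 (ltW C0) B0) (ltW c0)).
move=> a b; have [->|ab] := eqVneq a b; first by rewrite !subrr normr0 mulr0.
pose f x := b + (a - b) * @bump R n x.
have ab0 : 0 < `|a - b| by rewrite normr_gt0 subr_eq0.
have mf : lebesgue_measurable_fun f.
  apply: (@measurable_left_composition R n (fun t => b + (a - b) * t) _ _ mb).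
  apply: (@lipschitz_continuous R _ `|a - b|) => // x y.
  by rewrite (_ : _ - _ = (a - b) * (x - y)) ?normrM//; ring.
have fb : (JNQ_norm alpha p q f <= `|a - b|%:E * B%:E)%E.
  rewrite -bE; apply: (JNQ_norm_lipschitz _ q1 p1 mb mf ab0) => x y.
  by rewrite (_ : _ - _ = (a - b) * (bump x - bump y)) ?normrM// /f; ring.
have Jf : JNQ alpha p q f.
  by split; [exact: mf|apply: le_lt_trans fb _; rewrite -EFinM ltry].
have Lf1 x : `|x| <= 1 -> left_composition L f x = L a.
  by move=> x1; rewrite /left_composition /f bump_eq1// mulr1 addrC subrK.
have Lf2 x : 2 <= `|x| -> left_composition L f x = L b.
  by move=> x2; rewrite /left_composition /f bump_eq0// mulr0 addr0.
have mLf : lebesgue_measurable_fun (left_composition L f).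
  exact: measurable_left_composition.
have := le_trans (jump _ _ _ mLf Lf1 Lf2) (LC f Jf).
have Cfb : (C%:E * JNQ_norm alpha p q f <= C%:E * (`|a - b|%:E * B%:E))%E.
  by rewrite lee_wpmul2l// lee_fin ltW.
move=> /le_trans/(_ Cfb); rewrite -!EFinM lee_fin => cLab.
rewrite mulrDl mul1r; apply: (@le_trans _ _ (C * B / c * `|a - b|)); last by rewrite lerDl.
rewrite mulrAC ler_pdivlMr// mulrC; apply: le_trans cLab _.
by rewrite mulrAC mulrA.
Qed.

End Main.

Theorem theorem4p1 (R : realType) (n : nat) (alpha p q gamma : R) (L : R -> R)
    (hn : (1 <= n)%N) (halpha : alpha < 1) (hp : 1 <= p) (hq : 1 <= q)
    (hgamma : q <= gamma) (hpgamma : gamma^-1 = p^-1 + n%:R^-1)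
    (hL : continuous L) :
  (bounded_on_JNQ alpha p q (@left_composition R n L) <-> Lip R L) /\
  (forall f : 'rV[R]_n -> R,
    JNQ alpha p q f <->
    exists g : 'rV[R]_n -> R,
      [/\ JNQ alpha p q g,
          {ae lebesgue R n, forall x, g x != 0},
          JNQ alpha p q (fun x => (g x)^-1) &
          {ae lebesgue R n, forall x, f x = g x - (g x)^-1}]).
Proof.
have p0 : 0 < p by exact: lt_le_trans hp.
have q0 : 0 < q by exact: lt_le_trans hq.
have n0 : 0 < n%:R :> R by rewrite ltr0n.
have pnq : p^-1 + n%:R^-1 <= q^-1.
  by rewrite -hpgamma lef_pV2// posrE//; exact: lt_le_trans hgamma.
have qp : q <= p.
  rewrite -lef_pV2 ?posrE//; apply: le_trans pnq.
  by rewrite lerDl invr_ge0 ltW.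
have npq : n%:R + (q - n%:R) * (p / q) <= 0.
  rewrite (_ : _ + _ = n%:R * p * ((p^-1 + n%:R^-1) - q^-1)).
    by rewrite mulr_ge0_le0 ?subr_le0// mulr_ge0 ?ltW.
  by field; rewrite !gt_eqF.
have Jbump := JNQ_bump hn halpha hq qp npq.
split; first split.
- by move=> bL; apply/(LipP hL); apply: lipschitz_of_bounded Jbump hL bL.
- move=> /(LipP hL)[K K0 LK]; exists K => // f [mf _].
  have mLf := measurable_left_composition hL mf.
  by apply: (JNQ_norm_lipschitz _ hq hp mf mLf K0) => x y; exact: LK.
move=> f; split=> [Jf|[g [[mg glty] _ [mV Vlty] fg]]]; last first.
  have mf : lebesgue_measurable_fun f.
    by apply: ae_eq_lebesgue_measurable fg; exact: measurable_funB.
  by split; [exact: mf|exact: (JNQ_norm_sub hq hp mf mg mV fg)].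
have Jg := @JNQ_left_composition R n alpha p q hp hq (@upper_root R) 1 f ltr01.
have Jk := @JNQ_left_composition R n alpha p q hp hq (@lower_root R) 1 f ltr01.
exists (left_composition (@upper_root R) f); split.
- by apply: Jg => // x y; rewrite mul1r upper_root_lipschitz.
- by apply: aeW => x; exact: upper_root_neq0.
- rewrite (_ : (fun x => _) = left_composition (@lower_root R) f).
    by apply: Jk => // x y; rewrite mul1r lower_root_lipschitz.
  by apply/funext => x; exact: upper_rootV.
- by apply: aeW => x; rewrite /left_composition upper_rootV upper_rootB.
Qed.
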